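(* Let $\Omega\subset\mathbb{R}^n$ be a bounded domain and $1<p<\infty$. Let $v$ be a weight on $\Omega$ with $v\in L^1(\Omega)$, let $Q$ be a measurable, symmetric, nonnegative definite $n\times n$ matrix function on $\Omega$ with $|Q(x)|_{\mathrm{op}}^{p/2}\le k\,v(x)$ for a.e. $x\in\Omega$ (some constant $k$), and let $\mathbf t\cdot\nabla$ be a degenerate subunit vector field on $\Omega$. Suppose that for some $\sigma>1$ the Sobolev inequality $$\|\varphi\|_{L^N(v,\Omega)}\le S_N\|\nabla\varphi\|_{QL^p(\Omega)}\qquad\text{for all }\varphi\in \mathrm{Lip}_0(\Omega)$$ holds with $N(t)=t^{\sigma p}$. Let $q>\sigma'(p-1)$, where $\sigma'=\sigma/(\sigma-1)$, and let $f\in L^A(v,\Omega)$ and $g\in L^B(v,\Omega)$, where $$A(t)=t^{\sigma'(p-1)}\log(e+t)^q,\qquad B(t)=t^{p\sigma'}\log(e+t)^{qp'},\qquad p'=\tfrac{p}{p-1}.$$ Then there is a constant $C$, depending only on $A,B,N,\mathbf t,p,S_N,\Omega,v$ (and in particular independent of $u,f,g$), such that every degenerate weak subsolution $u\in QH^{1,p}_0(v,\Omega)$ of the Dirichlet problem (D) (see context) satisfies $$\|u^+\|_{L^\infty(v,\Omega)}\le C\big(\|f\|_{L^A(v,\Omega)}+\|g\|_{L^B(v,\Omega)}\big),$$ and every degenerate weak supersolution $u\in QH^{1,p}_0(v,\Omega)$ of (D) satisfies the same bound with $u^-$ in place of $u^+$. In particular, if $u$ is a degenerate weak solution of (D), then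 $u\in L^\infty(v,\Omega)$ with this bound.
   Context: A weight $v$ is a nonnegative measurable function; $v(E)=\int_E v\,dx$. $L^p(v,\Omega)$ is the Lebesgue space with respect to the measure $v\,dx$, and $\|\cdot\|_{L^\infty(v,\Omega)}$ is the essential supremum with respect to $v\,dx$. For an increasing function $\Phi:[0,\infty)\to[0,\infty)$ with $\Phi(0)=0$, $\|h\|_{L^\Phi(v,\Omega)}=\inf\{\lambda>0:\int_\Omega \Phi(|h|/\lambda)\,v\,dx\le 1\}$, and $L^\Phi(v,\Omega)$ is the set of measurable $h:\Omega\to\mathbb{R}$ for which this is finite. $\mathrm{Lip}_0(\Omega)$ is the set of locally Lipschitz functions with compact support in $\Omega$. $QL^p(\Omega)$ is the space of measurable $\mathbf g:\Omega\to\mathbb{R}^n$ with $\|\mathbf g\|_{QL^p(\Omega)}=(\int_\Omega|\sqrt{Q}\,\mathbf g|^p\,dx)^{1/p}<\infty$, with functions identified when their difference has norm $0$. $QH^{1,p}_0(v,\Omega)$ is the completion of $\mathrm{Lip}_0(\Omega)$ in the norm $\|\psi\|_{L^p(v,\Omega)}+\|\nabla\psi\|_{QL^p(\Omega)}$; its elements are identified with pairs $(u,\nabla u)\in L^p(v,\Omega)\times QL^p(\Omega)$ that are limits in $L^p(v,\Omega)\times QL^p(\Omega)$ of sequences $(\psi_j,\nabla\psi_j)$ with $\psi_j\in\mathrm{Lip}_0(\Omega)$. Here ''$\nabla u$'' is notation for the second component (it need not be a classical weak gradient), and one writes $u\in QH^{1,p}_0(v,\Omega)$ for the pair. For measurable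 $\mathbf t:\Omega\to\mathbb{R}^n$, $\mathbf t\cdot\nabla$ is a degenerate subunit vector field if there is a constant $C(\mathbf t)>0$ with $\|\mathbf t\cdot\nabla\varphi\|_{L^p(v,\Omega)}\le C(\mathbf t)\|\nabla\varphi\|_{QL^p(\Omega)}$ for every $\varphi\in\mathrm{Lip}_0(\Omega)$. Dependence of a constant on $\mathbf t$ includes dependence on $C(\mathbf t)$. The Dirichlet problem (D) is, formally, $$-v^{-1}\mathrm{div}(|\sqrt Q\nabla u|^{p-2}Q\nabla u)=f|f|^{p-2}-v^{-1}\mathrm{div}(v|g|^{p-2}g\,\mathbf t)\ \text{in }\Omega,\qquad u=0\text{ on }\partial\Omega,$$ with $f,g$ real-valued measurable functions. A pair $(u,\nabla u)\in QH^{1,p}_0(v,\Omega)$ is a degenerate weak solution of (D) if $$\int_\Omega|\sqrt Q\nabla u|^{p-2}\,\nabla\varphi\cdot Q\nabla u\,dx=\int_\Omega\big(f|f|^{p-2}\varphi+|g|^{p-2}g\,\mathbf t\cdot\nabla\varphi\big)\,v\,dx$$ for every $\varphi\in\mathrm{Lip}_0(\Omega)$. It is a degenerate weak subsolution (supersolution) if this holds with ''$=$'' replaced by ''$\le$'' (''$\ge$'') for every nonnegative $\varphi\in\mathrm{Lip}_0(\Omega)$. Expressions $|w|^{p-2}w$ are $0$ where $w=0$. Finally $u^+=\max(u,0)$, $u^-=\max(-u,0)$. *)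

(* Defs.v *)
From HB Require Import structures.
From mathcomp Require Import all_boot all_order all_algebra.
From mathcomp Require Import all_classical all_reals all_analysis.

Set Implicit Arguments.
Unset Strict Implicit.
Unset Printing Implicit Defensive.

Import Order.TTheory GRing.Theory Num.Theory.
Import numFieldNormedType.Exports.

Local Open Scope classical_set_scope.
Local Open Scope ring_scope.

(* Points of R^n are row vectors, since ['rV[R]_n] carries the topology and
   the (sup) norm of the library; the dimension has the form [n.+1] because
   n >= 1.  Lebesgue measure is the Caratheodory measure of the usual outer
   measure (coverings by countably many boxes), so that "measurable" means
   Lebesgue measurable. *)

Section lebesgue_measure_rV.
Context {R : realType} {n : nat}.
Local Open Scope ereal_scope.

Definition box (c : 'rV[R]_n.+1 * 'rV[R]_n.+1) : set 'rV[R]_n.+1 :=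
  [set x | forall i, c.1 ord0 i <= x ord0 i < c.2 ord0 i]%R.

Definition box_volume (c : 'rV[R]_n.+1 * 'rV[R]_n.+1) : R :=
  (\prod_(i < n.+1) Num.max (c.2 ord0 i - c.1 ord0 i) 0)%R.

Definition box_cover (A : set 'rV[R]_n.+1) :
    set (nat -> 'rV[R]_n.+1 * 'rV[R]_n.+1) :=
  [set c | A `<=` \bigcup_k box (c k)].

Definition lebesgue_outer (A : set 'rV[R]_n.+1) : \bar R :=
  ereal_inf [set \sum_(k <oo) (box_volume (c k))%:E | c in box_cover A].

Lemma box_volume_ge0 c : 0 <= (box_volume c)%:E.
Proof. by rewrite lee_fin; apply: prodr_ge0 => i _; rewrite le_max lexx orbT. Qed.

Lemma lebesgue_outer_ge0 A : 0 <= lebesgue_outer A.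
Proof.
apply: le_ereal_inf_tmp => _ [c Ac <-].
by apply: nneseries_ge0 => k _ _; exact: box_volume_ge0.
Qed.

Lemma le_lebesgue_outer : {homo lebesgue_outer : A B / A `<=` B >-> A <= B}.
Proof.
move=> A B AB; apply/ereal_inf_le_tmp => _ [c Bc <-].
by exists c => //; exact: subset_trans AB Bc.
Qed.

Lemma lebesgue_outer0 : lebesgue_outer set0 = 0.
Proof.
apply/eqP; rewrite eq_le lebesgue_outer_ge0 andbT.
apply: ereal_inf_lbound; exists (fun=> (0, 0)%R); first exact: sub0set.
apply: eseries0 => k _ _ /=.
by rewrite /box_volume big_ord_recl /= subrr maxxx mul0r.
Qed.

Lemma lebesgue_outer_sigma_subadditive : sigma_subadditive lebesgue_outer.
Proof.
move=> A; have [[i ioo]|] := pselect (exists i, lebesgue_outer (A i) = +oo).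
  rewrite (eseries_pinfty _ _ ioo) ?leey// => k _.
  by rewrite -ltNye (lt_le_trans _ (lebesgue_outer_ge0 _)).
rewrite -forallNE => Aoo.
suff add2e (e : {posnum R}) : lebesgue_outer (\bigcup_k A k) <=
    \sum_(i <oo) lebesgue_outer (A i) + e%:num%:E.
  by apply/lee_addgt0Pr => _/posnumP[].
rewrite (le_trans _ (epsilon_trick _ _ _))//; last first.
  by move=> k; exact: lebesgue_outer_ge0.
pose P k (c : nat -> 'rV[R]_n.+1 * 'rV[R]_n.+1) := box_cover (A k) c /\
  \sum_(j <oo) (box_volume (c j))%:E <=
  lebesgue_outer (A k) + (e%:num / (2 ^ k.+1)%:R)%:E.
have [G PG] : {G & forall k, P k (G k)}.
  apply: (@choice _ _ P) => k.
  have en1 : (0 < e%:num / (2 ^ k.+1)%:R :> R)%R by [].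
  have finA : lebesgue_outer (A k) \is a fin_num.
    by rewrite ge0_fin_numE ?lebesgue_outer_ge0// ltey; apply/eqP/Aoo.
  have [x [c Ac <-] xS] := lb_ereal_inf_adherent en1 finA.
  by exists c; split => //; exact/ltW.
pose vG (ij : nat * nat) := (box_volume (G ij.1 ij.2))%:E.
have vG_ge0 ij : 0 <= vG ij by exact: box_volume_ge0.
apply: (@le_trans _ _ (\esum_(ij in setT) vG ij)).
  have /card_esym/ppcard_eqP[f] := card_nat2.
  apply: ereal_inf_lbound; exists (fun k => G (f k).1 (f k).2).
    move=> t [i _ /(PG i).1[j _ tij]].
    by exists (f^-1%FUN (i, j)) => //=; rewrite invK ?inE.
  transitivity (\sum_(k <oo) vG (f k)) => //.
  rewrite -(esum_pred_image vG f xpredT) ?[fun=> _]set_true//.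
  by rewrite image_eq.
rewrite (_ : esum _ _ = \sum_(i <oo) \sum_(j <oo) vG (i, j)); last first.
  pose J k : set (nat * nat) := [set (k, j) | j in setT].
  rewrite (_ : setT = \bigcup_k J k); last first.
    by rewrite predeqE => -[a b]; split => // _; exists a => //; exists b.
  rewrite esum_bigcupT//=; last first.
    apply/trivIsetP => i j _ _ ij; rewrite predeqE => -[a b] /=; split => //=.
    by move=> [] [_] _ [<-{a} _] [m' _] [] /esym/eqP; rewrite (negbTE ij).
  rewrite -(image_id [set: nat]) -fun_true esum_pred_image//; last first.
    by move=> k _; exact: esum_ge0.
  apply: eq_eseriesr => /= j _.
  rewrite -(esum_pred_image vG (pair j) predT)//=; last first.
    by move=> ? ? _ _; exact: (@can_inj _ _ _ snd).
  by congr esum; rewrite predeqE => -[a b]; split; move=> [i _ <-]; exists i.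
apply: lee_lim.
- by apply: is_cvg_nneseries => k *; exact: nneseries_ge0.
- apply: is_cvg_nneseries => k *.
  by apply: adde_ge0 => //; exact: lebesgue_outer_ge0.
- by near=> k; apply: lee_sum => i _; exact: (PG i).2.
Unshelve. all: by end_near. Qed.

HB.instance Definition _ := isOuterMeasure.Build R 'rV[R]_n.+1 lebesgue_outer
  lebesgue_outer0 lebesgue_outer_ge0 le_lebesgue_outer
  lebesgue_outer_sigma_subadditive.

HB.instance Definition _ :=
  Measurable.copy 'rV[R]_n.+1 (caratheodory_type lebesgue_outer).

Definition leb : set 'rV[R]_n.+1 -> \bar R := lebesgue_outer.
HB.instance Definition _ := isMeasure.Build _ 'rV[R]_n.+1 R leb
  (@caratheodory_measure0 _ _ lebesgue_outer)
  (@caratheodory_measure_ge0 _ _ lebesgue_outer)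
  (@caratheodory_measure_sigma_additive _ _ lebesgue_outer).

End lebesgue_measure_rV.

Arguments leb {R n}.

(* Values of vector fields are column vectors, with the Euclidean structure. *)

Section euclidean.
Context {R : realType} {n : nat}.
Implicit Types (a b xi : 'cV[R]_n.+1) (M S : 'M[R]_n.+1).

Definition dot a b : R := \sum_(i < n.+1) a i ord0 * b i ord0.

Definition enorm a : R := Num.sqrt (dot a a).

Definition nonneg_def M := forall xi, 0 <= dot xi (M *m xi).

(* The symmetric nonnegative definite square root, which exists and is unique
   for M symmetric and nonnegative definite (0 is a dummy value otherwise). *)
Definition sqrtmx M : 'M[R]_n.+1 :=
  xget 0 [set S | [/\ S^T = S, nonneg_def S & S *m S = M]].

Definition opnorm M : R :=
  sup [set enorm (M *m xi) | xi in [set xi | enorm xi <= 1]].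

End euclidean.

(* Functions on Omega are represented by functions on R^n whose values outside
   Omega are never used; weights are real-valued. *)

Section spaces.
Context {R : realType} {n : nat}.
Local Notation Rn := 'rV[R]_n.+1.
Local Notation field := (Rn -> 'cV[R]_n.+1).
Implicit Types (Omega : set Rn) (v h phi u : Rn -> R) (g t U : field).
Implicit Types (Q : Rn -> 'M[R]_n.+1) (p : R) (Phi : R -> R).

Definition bounded_domain Omega :=
  [/\ open Omega, connected Omega, Omega !=set0 & bounded_set Omega].

Definition measurable_field Omega g :=
  forall i, measurable_fun Omega (fun x => g x i ord0).

Definition measurable_mx_field Omega Q :=
  forall i j, measurable_fun Omega (fun x => Q x i j).

Definition weight Omega v :=
  measurable_fun Omega v /\ forall x, Omega x -> 0 <= v x.

Definition weight_of v (E : set Rn) : \bar R := (\int[leb]_(x in E) (v x)%:E)%E.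

Definition Lp_norm p v Omega h : \bar R :=
  ((\int[leb]_(x in Omega) (`|h x| `^ p * v x)%:E) `^ p^-1)%E.

Definition in_Lp p v Omega h :=
  measurable_fun Omega h /\ (Lp_norm p v Omega h < +oo)%E.

Definition Linfty_norm v Omega h : \bar R :=
  ereal_inf [set M%:E | M in [set M | 0 <= M /\
    weight_of v (Omega `&` [set x | M < `|h x|]) = 0%E]].

Definition in_Linfty v Omega h :=
  measurable_fun Omega h /\ (Linfty_norm v Omega h < +oo)%E.

Definition orlicz_norm Phi v Omega h : \bar R :=
  ereal_inf [set l%:E | l in [set l | 0 < l /\
    (\int[leb]_(x in Omega) (Phi (`|h x| / l) * v x)%:E <= 1)%E]].

Definition in_orlicz Phi v Omega h :=
  measurable_fun Omega h /\ (orlicz_norm Phi v Omega h < +oo)%E.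

Definition QLp_norm p Q Omega g : \bar R :=
  ((\int[leb]_(x in Omega) (enorm (sqrtmx (Q x) *m g x) `^ p)%:E) `^ p^-1)%E.

Definition in_QLp p Q Omega g :=
  measurable_field Omega g /\ (QLp_norm p Q Omega g < +oo)%E.

(* The partial derivatives of a locally Lipschitz function exist almost
   everywhere; ['D_] takes the value 0 where a limit does not exist. *)
Definition grad phi : field :=
  fun x => \col_(i < n.+1) 'D_(delta_mx ord0 i) phi x.

(* Elements of Lip_0 are extended by 0 outside Omega. *)
Definition Lip0 Omega phi :=
  [/\ forall x, Omega x -> lipschitz_on phi (nbhs (x, x)),
      compact (closure [set x | phi x != 0]) &
      closure [set x | phi x != 0] `<=` Omega].

(* Elements of the completion, as pairs (u, U) with U standing for the second
   component, written "grad u" informally. *)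
Definition in_QH0 p v Q Omega u U :=
  [/\ in_Lp p v Omega u, in_QLp p Q Omega U &
      exists psi : nat -> Rn -> R,
        [/\ forall j, Lip0 Omega (psi j),
            Lp_norm p v Omega (psi j \- u) @[j --> \oo] --> 0%E &
            QLp_norm p Q Omega (grad (psi j) \- U) @[j --> \oo] --> 0%E]].

Definition degenerate_subunit p v Q Omega t (Ct : R) :=
  0 < Ct /\ forall phi, Lip0 Omega phi ->
    (Lp_norm p v Omega (fun x => dot (t x) (grad phi x))
       <= Ct%:E * QLp_norm p Q Omega (grad phi))%E.

Definition sobolev_inequality Phi p v Q Omega (S : R) :=
  forall phi, Lip0 Omega phi ->
    (orlicz_norm Phi v Omega phi <= S%:E * QLp_norm p Q Omega (grad phi))%E.

End spaces.

Section dirichlet.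
Context {R : realType} {n : nat}.
Local Notation Rn := 'rV[R]_n.+1.
Local Notation field := (Rn -> 'cV[R]_n.+1).
Implicit Types (Omega : set Rn) (v f g phi u : Rn -> R) (t U : field).
Implicit Types (Q : Rn -> 'M[R]_n.+1) (p : R).

Definition weak_lhs p Q Omega U phi : \bar R :=
  (\int[leb]_(x in Omega)
     (enorm (sqrtmx (Q x) *m U x) `^ (p - 2)
        * dot (grad phi x) (Q x *m U x))%:E)%E.

Definition weak_rhs p v t Omega f g phi : \bar R :=
  (\int[leb]_(x in Omega)
     ((f x * `|f x| `^ (p - 2) * phi x
       + `|g x| `^ (p - 2) * g x * dot (t x) (grad phi x)) * v x)%:E)%E.

Definition weak_solution p v Q t Omega f g u U :=
  in_QH0 p v Q Omega u U /\ forall phi, Lip0 Omega phi ->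
    weak_lhs p Q Omega U phi = weak_rhs p v t Omega f g phi.

Definition weak_subsolution p v Q t Omega f g u U :=
  in_QH0 p v Q Omega u U /\
  forall phi, Lip0 Omega phi -> (forall x, 0 <= phi x) ->
    (weak_lhs p Q Omega U phi <= weak_rhs p v t Omega f g phi)%E.

Definition weak_supersolution p v Q t Omega f g u U :=
  in_QH0 p v Q Omega u U /\
  forall phi, Lip0 Omega phi -> (forall x, 0 <= phi x) ->
    (weak_lhs p Q Omega U phi >= weak_rhs p v t Omega f g phi)%E.

End dirichlet.

Section orlicz_functions.
Context {R : realType}.
Implicit Types p sigma q t : R.

Definition conjugate p : R := p / (p - 1).

Definition Nfun sigma p t : R := t `^ (sigma * p).

Definition Afun sigma p q t : R :=
  t `^ (conjugate sigma * (p - 1)) * ln (expR 1 + t) `^ q.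

Definition Bfun sigma p q t : R :=
  t `^ (p * conjugate sigma) * ln (expR 1 + t) `^ (q * conjugate p).

End orlicz_functions.

(* Main.v *)
(* De Giorgi iteration on the superlevel sets of u, for the measure v dx.
   At a level k, a single psi in Lip_0 close to (u, U) is truncated to
   phi = G(psi) and used as test function, where G vanishes below k, is C^1 and
   has 0 <= G' <= 1. Errors caused by replacing (u, U) with (psi, grad psi) are
   made as small as needed, so no limit is taken and no almost everywhere
   convergence is used. Testing with phi and Hoelder's inequality bound the
   energy of phi by the integrals of f and g over {psi > k}. The Orlicz
   condition bounds these: if that set has mass at most M e^(-j), the energy is
   O(lam e^(-j/(sigma p)) (1 + j)^(-a)), with lam the size of the data and
   a = q / (sigma' (p - 1)) > 1. By Sobolev and Chebyshev the mass drops by a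
   factor e when the level is raised by O(lam (1 + j)^(-a)). Since a > 1, these
   increments are summable. *)

Require Import Defs.
From mathcomp Require Import all_boot all_order all_algebra.
From mathcomp Require Import all_classical all_reals all_analysis.
From mathcomp Require Import measurable_realfun.
From mathcomp Require Import ring lra complex.

Set Implicit Arguments.
Unset Strict Implicit.
Unset Printing Implicit Defensive.

Import Order.TTheory GRing.Theory Num.Theory.
Import numFieldNormedType.Exports.

Local Open Scope classical_set_scope.
Local Open Scope ring_scope.

(** * Lebesgue measurability of Borel sets *)

(** The powers of t in A and B are critical: with powers alone, a set of mass e^(-j) gives an energy
    of order e^(-j/(sigma p)), and Sobolev with Chebyshev then lowers the mass by a fixed factor
    only for level increments of constant size. The logarithms supply the extra factor (1 + j)^(-a).
    The exponent q p' in B makes the term in g gain exactly the same factor as the term in f, and q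
    > sigma' (p - 1) says that a > 1. The obstacle is that U is only a limit in QL^p and need not be
    a gradient of u, so no chain rule for (u - k)^+ is at hand. Truncating psi instead costs an
    exchange of u and psi at each level, paid for by splitting every increment into three equal
    widths. The function psi may depend on j and on the energy of u, because its distance to (u, U)
    does not enter the constant. Partial derivatives take a dummy value where they do not exist, so
    the chain rule is an identity of limits, convergent or not. *)

Section borel_rV.
Context {R : realType} {n : nat}.
Local Notation Rn := 'rV[R]_n.+1.
Local Open Scope ereal_scope.

(** Only the factor of index [i] changes. The maximum with 0 in [box_volume] makes the identity hold
    for empty boxes and for [r] outside the side as well. *)
Lemma box_volume_split (i : 'I_n.+1) (r : R) (c : Rn * Rn) :
  (box_volume c =
   box_volume (c.1, \row_j (if j == i then Num.min (c.2 ord0 j) r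
                            else c.2 ord0 j)) +
   box_volume (\row_j (if j == i then Num.max (c.1 ord0 j) r
                       else c.1 ord0 j), c.2))%R.
Proof.
rewrite /box_volume (bigD1 i)//= [X in (_ = X + _)%R](bigD1 i)//=.
rewrite [X in (_ = _ + X)%R](bigD1 i)//= !mxE eqxx.
rewrite [X in (_ = _ * X + _)%R](_ : _ =
  \prod_(j < n.+1 | j != i) Num.max (c.2 ord0 j - c.1 ord0 j) 0)%R; last first.
  by apply: eq_bigr => j ji; rewrite mxE (negbTE ji).
rewrite [X in (_ = _ + _ * X)%R](_ : _ =
  \prod_(j < n.+1 | j != i) Num.max (c.2 ord0 j - c.1 ord0 j) 0)%R; last first.
  by apply: eq_bigr => j ji; rewrite mxE (negbTE ji).
rewrite -mulrDl; congr (_ * _)%R.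
set a := c.1 _ _; set b := c.2 _ _.
rewrite /Num.min /Num.max.
by case: (ltP b r) => ?; case: (ltP a r) => ?; repeat case: ltP => ? //; lra.
Qed.

(** Cutting each box of a cover along the hyperplane gives covers of the two pieces with the same
    total volume, which is Caratheodory's criterion. *)
Lemma measurable_halfspace (i : 'I_n.+1) (r : R) :
  measurable [set x : Rn | (x ord0 i < r)%R].
Proof.
apply: le_caratheodory_measurable => X.
apply: le_ereal_inf_tmp => _ [c Xc <-].
pose cl k := ((c k).1, \row_j (if j == i then Num.min ((c k).2 ord0 j) r
                               else (c k).2 ord0 j))%R : Rn * Rn.
pose cr k := (\row_j (if j == i then Num.max ((c k).1 ord0 j) r
                      else (c k).1 ord0 j), (c k).2)%R : Rn * Rn.
rewrite (_ : limn _ = \sum_(k <oo) (box_volume (cl k))%:E +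
                      \sum_(k <oo) (box_volume (cr k))%:E); last first.
  rewrite -nneseriesD; [|by move=> *; exact: box_volume_ge0..].
  by apply: eq_eseriesr => k _; rewrite -EFinD -box_volume_split.
apply: leeD; apply: ereal_inf_lbound.
  exists cl => // x [/Xc[k _ kx] /= xr]; exists k => // j /=.
  rewrite mxE; case: eqP => [->|_]; last exact: kx.
  by have /andP[-> /=] := kx i; rewrite lt_min xr andbT.
exists cr => // x [/Xc[k _ kx] /= /negP]; rewrite -leNgt => xr.
exists k => // j /=.
rewrite mxE; case: eqP => [->|_]; last exact: kx.
by have /andP[ax ->] := kx i; rewrite ge_max ax xr.
Qed.

Lemma measurable_box (c : Rn * Rn) : measurable (box c).
Proof.
have -> : box c = \bigcap_(i in [set: 'I_n.+1])
    (~` [set x | (x ord0 i < c.1 ord0 i)%R] `&` [set x | (x ord0 i < c.2 ord0 i)%R]).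
  apply/seteqP; split => x cx i => [_|].
    by have /andP[c1 c2] := cx i; split => //=; apply/negP; rewrite -leNgt.
  by have [/= /negP] := cx i I; rewrite -leNgt => -> ->.
apply: fin_bigcap_measurable; first exact: finite_finset.
move=> i _; apply: measurableI; last exact: measurable_halfspace.
by apply: measurableC; exact: measurable_halfspace.
Qed.

(** An open set is the countable union of the boxes with rational corners that it contains. Corners
    within [e / 2] of a point suffice because the norm is the sup norm. *)
Lemma rV_open_measurable (A : set Rn) : open A -> measurable A.
Proof.
move=> oA.
pose B (q : 'rV[rat]_n.+1 * 'rV[rat]_n.+1) : set Rn :=
  box (map_mx ratr q.1, map_mx ratr q.2).
have -> : A = \bigcup_(q in [set q | B q `<=` A]) B q.
  apply/seteqP; split=> [x Ax|x [qe BA Bx]]; last exact: BA.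
  have : nbhs x A by apply: open_nbhs_nbhs; split.
  rewrite -filter_from_ballE => -[e /= e0 xeA].
  have /choice[a ax] : forall i, exists q : rat,
      (x ord0 i - e / 2 < ratr q < x ord0 i)%R.
    move=> i; have : (x ord0 i - e / 2 < x ord0 i)%R by lra.
    by move=> /rat_in_itvoo[q]; rewrite in_itv/=; exists q.
  have /choice[b bx] : forall i, exists q : rat,
      (x ord0 i < ratr q < x ord0 i + e / 2)%R.
    move=> i; have : (x ord0 i < x ord0 i + e / 2)%R by lra.
    by move=> /rat_in_itvoo[q]; rewrite in_itv/=; exists q.
  exists (\row_i a i, \row_i b i)%R => /=; last first.
    move=> i; rewrite !mxE; have /andP[_ /ltW ->] := ax i.
    by have /andP[-> _] := bx i.
  move=> y By; apply: xeA; rewrite mx_norm_ball /ball_ /=.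
  rewrite /Num.Def.normr/= mx_normrE.
  apply: (@le_lt_trans _ _ (e / 2)%R); last by lra.
  apply/bigmax_leP; split => /=; first by lra.
  move=> [i j] _ /=; rewrite !mxE ord1.
  have := By j; rewrite !mxE => /andP[? ?].
  have /andP[? ?] := ax j; have /andP[? ?] := bx j.
  by rewrite ler_norml; apply/andP; split; lra.
rewrite bigcup_mkcond; apply: countable_bigcupT_measurable => [|qe].
  exact: countableP.
by case: ifP => // _; exact: measurable_box.
Qed.

Lemma rV_closed_measurable (A : set Rn) : closed A -> measurable A.
Proof.
move=> cA; rewrite -(setCK A); apply: measurableC.
exact/rV_open_measurable/closed_openC.
Qed.

Lemma rV_continuous_measurable (D : set Rn) (h : Rn -> R) :
  measurable D -> continuous h -> measurable_fun D h.
Proof.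
move=> mD ch; apply: (measurability _ (RGenOpens.measurableE R)).
move=> _ [_ [a [b ->]] <-]; apply: measurableI => //.
apply: rV_open_measurable; apply: open_comp => //.
Qed.

End borel_rV.

(** * Square roots of symmetric nonnegative definite matrices *)

(** Serves to realize a function of a matrix as a polynomial in it. *)
Lemma interpolation (F : fieldType) (s : seq F) (f : F -> F) :
  exists p : {poly F}, forall x, x \in s -> p.[x] = f x.
Proof.
elim: s => [|a s [p ps]]; first by exists 0.
have [as_|as_] := boolP (a \in s).
  by exists p => x; rewrite inE => /predU1P[->|]; exact: ps.
pose w := \prod_(b <- s) ('X - b%:P).
have wa : w.[a] != 0.
  rewrite -/(root w a) /w root_prod_XsubC //.
exists (p + ((f a - p.[a]) / w.[a]) *: w) => x; rewrite inE !hornerE.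
move=> /predU1P[->|xs]; first by rewrite mulfVK// addrC subrK.
have /eqP -> : root w x by rewrite root_prod_XsubC.
by rewrite mulr0 addr0 ps.
Qed.

(* M is symmetric over a real field, but the spectral theorem is available only
   over its complex closure: the conclusion is phrased with polynomials over F
   so that it descends from K to F. *)
Lemma diagonalizable_annihilated (F K : fieldType) (f : {rmorphism F -> K}) n
    (M : 'M[F]_n.+1) (P : 'M[K]_n.+1) (mu : 'I_n.+1 -> F) : P \in unitmx ->
  map_mx f M = invmx P *m diag_mx (\row_i f (mu i)) *m P ->
  exists2 s : seq F, (forall r, r \in s -> eigenvalue M r) &
    forall p : {poly F}, (forall r, r \in s -> p.[r] = 0) -> horner_mx M p = 0.
Proof.
move=> Pu ME; exists [seq mu i | i <- enum 'I_n.+1].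
  move=> _ /mapP[i _ ->]; rewrite -(eigenvalue_map f); apply/eigenvalueP.
  exists (row i P).
    rewrite ME -row_mul !mulmxA mulmxV// mul1mx row_mul row_diag_mx mxE.
    by rewrite -scalemxAl -rowE.
  apply: contraTneq Pu => Pi0; rewrite unitmxE unitfE negbK.
  rewrite (expand_det_row _ i) big1// => j _; have /rowP/(_ j) := Pi0.
  by rewrite !mxE => ->; rewrite mul0r.
move=> p p0; apply: (@map_mx_inj _ _ f).
rewrite map_mx0 map_horner_mx ME horner_mx_uconjC// horner_mx_diag.
rewrite (_ : map_mx _ _ = 0) ?linear0 ?mulmx0 ?mul0mx //.
apply/rowP => i; rewrite !mxE horner_map p0 ?rmorph0//.
by apply/mapP; exists i => //; rewrite mem_enum.
Qed.

Section symmetric_sqrt.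
Context {R : realType} {n : nat}.
Implicit Types (M : 'M[R]_n.+1) (x y : 'cV[R]_n.+1).

Lemma dotC x y : dot x y = dot y x.
Proof. by apply: eq_bigr => i _; rewrite mulrC. Qed.

Lemma dotE x y : dot x y = (x^T *m y) ord0 ord0.
Proof. by rewrite mxE; apply: eq_bigr => i _; rewrite mxE. Qed.

Lemma dot_mulmx M x y : dot x (M *m y) = dot (M^T *m x) y.
Proof. by rewrite !dotE trmx_mul trmxK mulmxA. Qed.

Lemma dotDl x y z : dot (x + y) z = dot x z + dot y z.
Proof. by rewrite -big_split/=; apply: eq_bigr => i _; rewrite mxE mulrDl. Qed.

Lemma dotZl (a : R) x y : dot (a *: x) y = a * dot x y.
Proof. by rewrite big_distrr/=; apply: eq_bigr => i _; rewrite mxE mulrA. Qed.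

Lemma dotNr x y : dot x (- y) = - dot x y.
Proof. by rewrite dotC -scaleN1r dotZl mulN1r dotC. Qed.

Lemma dot0l x : dot 0 x = 0.
Proof. by rewrite -(scale0r x) dotZl mul0r. Qed.

Lemma dot_ge0 x : 0 <= dot x x.
Proof. by apply: sumr_ge0 => i _; rewrite -expr2 sqr_ge0. Qed.

Lemma dot_eq0 x : (dot x x == 0) = (x == 0).
Proof.
apply/idP/eqP => [|->]; last by rewrite /dot big1// => i _; rewrite mxE mul0r.
rewrite psumr_eq0 => [/allP x0|i _]; last by rewrite -expr2 sqr_ge0.
apply/matrixP => i j; rewrite ord1 mxE.
by have := x0 i (mem_index_enum _); rewrite -expr2 sqrf_eq0 => /eqP.
Qed.

Lemma enorm_ge0 x : 0 <= enorm x.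
Proof. exact: sqrtr_ge0. Qed.

Lemma sqr_enorm x : enorm x ^+ 2 = dot x x.
Proof. by rewrite sqr_sqrtr// dot_ge0. Qed.

Lemma enormN x : enorm (- x) = enorm x.
Proof. by rewrite /enorm -scaleN1r dotZl dotC dotZl mulrA mulrNN !mul1r. Qed.

Lemma enormZ (a : R) x : 0 <= a -> enorm (a *: x) = a * enorm x.
Proof.
move=> a0; rewrite /enorm dotZl dotC dotZl mulrA -expr2 sqrtrM ?sqr_ge0//.
by rewrite sqrtr_sqr ger0_norm.
Qed.

Lemma dot_le_enorm x y : `|dot x y| <= enorm x * enorm y.
Proof.
rewrite -ler_sqr ?nnegrE ?mulr_ge0 ?enorm_ge0// real_normK ?num_real// exprMn !sqr_enorm.
have [->|y0] := eqVneq y 0.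
  by rewrite dotC !dot0l mulr0 expr0n.
have yy : 0 < dot y y by rewrite lt_def dot_ge0 dot_eq0 y0.
have := dot_ge0 (dot y y *: x + - dot x y *: y).
rewrite dotDl !dotZl !(dotC _ (_ + _)) !dotDl !dotZl (dotC y x).
set a := dot x x; set b := dot x y; set c := dot y y in yy *.
have -> : c * (c * a + - b * b) + - b * (c * b + - b * c) = c * (a * c - b ^+ 2).
  by ring.
by rewrite pmulr_rge0// subr_ge0.
Qed.

Lemma enormD x y : enorm (x + y) <= enorm x + enorm y.
Proof.
rewrite -ler_sqr ?nnegrE ?addr_ge0 ?enorm_ge0//.
rewrite sqr_enorm dotDl !(dotC _ (_ + _)) !dotDl sqrrD !sqr_enorm (dotC y x).
have := dot_le_enorm x y => /(le_trans (ler_norm _)).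
by move: (dot x x) (dot x y) (dot y y) (enorm x * enorm y) => a b c d; lra.
Qed.

Lemma trmx_horner M (p : {poly R}) : M^T = M -> (horner_mx M p)^T = horner_mx M p.
Proof.
move=> Msym; elim/poly_ind: p => [|p c ih]; first by rewrite rmorph0 trmx0.
rewrite rmorphD rmorphM /= horner_mx_X horner_mx_C linearD /= tr_scalar_mx.
congr (_ + _); rewrite trmx_mul ih Msym.
by have := comm_mx_horner p (comm_mx_refl M).
Qed.

(** The complexified matrix is Hermitian, so its spectral values are real and are the images of the
    reals [mu i]. *)
Lemma symmetric_spectrum M : M^T = M ->
  exists2 s : seq R, (forall r, r \in s -> eigenvalue M r) &
    forall p : {poly R}, (forall r, r \in s -> p.[r] = 0) -> horner_mx M p = 0.
Proof.
move=> Msym; set MC := map_mx (real_complex R) M.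
have MCherm : MC \is hermsymmx.
  apply/is_hermitianmxP; rewrite expr0 scale1r; apply/matrixP => i j.
  rewrite !mxE -{1}Msym mxE; apply/esym/CrealP.
  by rewrite complex_real.
have /orthomx_spectralP MCE := hermitian_normalmx MCherm.
have := hermitian_spectral_diag_real MCherm => /mxOverP Dreal.
pose mu i := complex.Re (spectral_diag MC ord0 i).
have muE : spectral_diag MC = \row_i real_complex R (mu i).
  by apply/rowP => i; rewrite mxE; apply/esym/RRe_real.
move: MCE; rewrite muE; exact: diagonalizable_annihilated (spectral_unit MC).
Qed.

(** [sqrtmx] is a choice, so it is enough to exhibit one root. A polynomial in [M] inherits the
    symmetry of [M], and identities between such polynomials need checking on the spectrum only. *)
Lemma sqrtmxP M : M^T = M -> nonneg_def M ->
  [/\ (sqrtmx M)^T = sqrtmx M, nonneg_def (sqrtmx M) & sqrtmx M *m sqrtmx M = M].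
Proof.
move=> Msym Mge0; rewrite /sqrtmx; set A := [set S | _].
suff : exists S, A S by move=> /(xgetPex 0).
have [s sM s0] := symmetric_spectrum Msym.
have [p ps] := interpolation s (fun r => Num.sqrt (Num.sqrt r)).
(* Eigenvectors are rows here; symmetry turns the transpose of one into an eigenvector for the
   action on columns, where [nonneg_def] applies. *)
have s_ge0 r : r \in s -> 0 <= r.
  move=> /sM/eigenvalueP[w wM w0].
  have : 0 <= dot w^T (M *m w^T) by exact: Mge0.
  rewrite dot_mulmx Msym -{1}Msym -trmx_mul wM linearZ/= dotZl.
  rewrite pmulr_lge0// lt_def dot_ge0 dot_eq0 andbT.
  by apply: contra w0 => /eqP/(congr1 trmx); rewrite trmxK trmx0 => ->.
(* p interpolates fourth roots, so that T ^ 2 is nonnegative as a square. *)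
pose T := horner_mx M p; have TT : T^T = T by exact: trmx_horner.
exists (T *m T); split.
- by rewrite trmx_mul TT.
- by move=> x; rewrite -mulmxA dot_mulmx TT dot_ge0.
- apply/eqP; rewrite -subr_eq0; apply/eqP.
  rewrite -[RHS](s0 (p ^+ 4 - 'X)).
    by rewrite rmorphB rmorphXn /= horner_mx_X -/T !mulmxE !exprS expr0 mulr1 !mulrA.
  move=> r rs; rewrite !hornerE ps// (exprM _ 2 2) !sqr_sqrtr ?sqrtr_ge0 ?s_ge0//.
  by rewrite subrr.
Qed.

Lemma dot_sqrtmx M x y : M^T = M -> nonneg_def M ->
  dot x (M *m y) = dot (sqrtmx M *m x) (sqrtmx M *m y).
Proof.
move=> Msym Mge0; have [St _ SS] := sqrtmxP Msym Mge0.
by rewrite -{1}SS -mulmxA dot_mulmx St.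
Qed.

End symmetric_sqrt.

(** * Truncations and gradients of functions in Lip_0 *)

Section truncation.
Context {R : realType}.
Implicit Types k d s : R.

(* trunc is a C^1 version of (s - k)^+ and dtrunc its derivative; being C^1, it
   obeys the chain rule of [derive_trunc] at every point. *)
Definition trunc k d s : R := Num.max (s - k) 0 ^+ 2 / (Num.max (s - k) 0 + d).

Definition dtrunc k d s : R := 1 - (d / (Num.max (s - k) 0 + d)) ^+ 2.

Lemma trunc_ge0 k d s : 0 < d -> 0 <= trunc k d s.
Proof.
by move=> d0; rewrite divr_ge0 ?sqr_ge0// addr_ge0 ?(ltW d0)// le_max lexx orbT.
Qed.

Lemma trunc_le k d s : s <= k -> trunc k d s = 0.
Proof. by move=> sk; rewrite /trunc max_r ?subr_le0// expr0n mul0r. Qed.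

Lemma dtrunc_le k d s : 0 < d -> s <= k -> dtrunc k d s = 0.
Proof.
by move=> d0 sk; rewrite /dtrunc max_r ?subr_le0// add0r divff ?gt_eqF// expr1n subrr.
Qed.

Lemma trunc_ge k d s : 0 < d -> k + d <= s -> d / 2 <= trunc k d s.
Proof.
move=> d0 kds; have x0 : d <= s - k by lra.
rewrite /trunc max_l; last lra.
rewrite ler_pdivlMr; last lra.
by move: (s - k) x0 => x xd; nra.
Qed.

Lemma dtrunc_itv k d s : 0 < d -> 0 <= dtrunc k d s <= 1.
Proof.
move=> d0; rewrite /dtrunc; set x := Num.max _ _.
have x0 : 0 <= x by rewrite le_max lexx orbT.
have : 0 <= d / (x + d) <= 1.
  by rewrite ler_pdivrMr ?divr_ge0//=; lra.
by move: (d / _) => y /andP[y0 y1]; apply/andP; split; nra.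
Qed.

(** The explicit remainder serves twice: it gives the chain rule for difference quotients, and, used
    at both endpoints, the Lipschitz bound of [dtrunc]. *)
Lemma trunc_taylor k d s t : 0 < d ->
  `|trunc k d t - trunc k d s - dtrunc k d s * (t - s)| <= (t - s) ^+ 2 / d.
Proof.
move=> d0.
have truncE x : 0 <= x -> x ^+ 2 / (x + d) = x - d + d ^+ 2 / (x + d).
  by move=> x0; field; lra.
have key x y : 0 <= x -> 0 <= y ->
    0 <= y ^+ 2 / (y + d) - x ^+ 2 / (x + d) - (1 - (d / (x + d)) ^+ 2) * (y - x)
      <= (y - x) ^+ 2 / d.
  move=> x0 y0; rewrite !truncE//.
  have -> : y - d + d ^+ 2 / (y + d) - (x - d + d ^+ 2 / (x + d)) -
      (1 - (d / (x + d)) ^+ 2) * (y - x) =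
      (y - x) ^+ 2 / d * (d / (y + d) * (d / (x + d)) ^+ 2).
    by field; lra.
  have /andP[a0 a1] : 0 <= d / (x + d) <= 1 by rewrite ler_pdivrMr ?divr_ge0//=; lra.
  have /andP[b0 b1] : 0 <= d / (y + d) <= 1 by rewrite ler_pdivrMr ?divr_ge0//=; lra.
  have c0 : 0 <= (y - x) ^+ 2 / d by rewrite divr_ge0 ?sqr_ge0 ?ltW.
  move: (d / (x + d)) (d / (y + d)) a0 a1 b0 b1 => a b a0 a1 b0 b1.
  have ba0 : 0 <= b * a ^+ 2 by rewrite mulr_ge0 ?sqr_ge0.
  have ba1 : b * a ^+ 2 <= 1 by nra.
  by apply/andP; split; [exact: mulr_ge0|rewrite ler_piMr].
(* Needed when [t < k <= s]: the part [k - t] of the step lies below the level, and its linear term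
   must fit in the cross term of the expanded square. *)
have slope x : 0 <= x -> 0 <= 1 - (d / (x + d)) ^+ 2 <= 2 * x / d.
  move=> x0.
  have /andP[a0 a1] : 0 <= d / (x + d) <= 1 by rewrite ler_pdivrMr ?divr_ge0//=; lra.
  have a2 : 1 - d / (x + d) <= x / d.
    have -> : 1 - d / (x + d) = x / (x + d) by field; lra.
    by rewrite ler_wpM2l// lef_pV2 ?posrE; lra.
  by rewrite -mulrA; move: (d / (x + d)) (x / d) a0 a1 a2 => a b a0 a1 a2;
    apply/andP; split; nra.
rewrite /trunc /dtrunc.
have [ks|sk] := leP k s; have [kt|tk] := leP k t.
- rewrite !max_l ?subr_ge0//.
  have /andP[h1 h2] := key (s - k) (t - k) ltac:(by rewrite subr_ge0) ltac:(by rewrite subr_ge0).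
  have e : t - k - (s - k) = t - s by ring.
  by rewrite e in h1 h2; rewrite ger0_norm.
- rewrite (max_r (_ : t - k <= 0)) ?max_l ?subr_ge0//; last by rewrite subr_le0 ltW.
  have s0 : 0 <= s - k by rewrite subr_ge0.
  have t0 : 0 <= k - t by rewrite subr_ge0 ltW.
  have /andP[h1 h2] := key (s - k) 0 s0 (lexx _).
  have /andP[h3 h4] := slope _ s0.
  have e : t - s = (0 - (s - k)) - (k - t) by ring.
  rewrite e; move: (s - k) (k - t) s0 t0 h1 h2 h3 h4 => x y x0 y0.
  rewrite expr0n !(add0r, mul0r); move: (x ^+ 2 / _) (1 - _) => A B h1 h2 h3 h4.
  have h5 : B * y <= 2 * x * y / d by rewrite mulrAC ler_wpM2r.
  have h6 : 0 <= B * y by rewrite mulr_ge0.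
  have e2 : (- x - y) ^+ 2 / d = (- x) ^+ 2 / d + 2 * x * y / d + y ^+ 2 / d by field; lra.
  have h7 : 0 <= y ^+ 2 / d by rewrite divr_ge0 ?sqr_ge0 ?ltW.
  have e3 : B * (- x - y) = B * (- x) - B * y by ring.
  by rewrite e2 e3 ger0_norm; lra.
- rewrite (max_r (_ : s - k <= 0)) ?max_l ?subr_ge0//; last by rewrite subr_le0 ltW.
  rewrite expr0n /= ?mul0r (add0r d) divff ?gt_eqF// expr1n subrr mul0r !subr0.
  have t0 : 0 <= t - k by rewrite subr_ge0.
  rewrite ger0_norm; last by rewrite divr_ge0 ?sqr_ge0//; lra.
  apply: ler_pM; [exact: sqr_ge0|by rewrite invr_ge0; lra| |].
    by rewrite ler_sqr ?nnegrE; lra.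
  by rewrite lef_pV2 ?posrE; lra.
- have s0 : s - k <= 0 by lra.
  have t0 : t - k <= 0 by lra.
  rewrite (max_r s0) (max_r t0).
  rewrite expr0n /= ?mul0r (add0r d) divff ?gt_eqF// expr1n !subrr mul0r subrr normr0.
  by rewrite divr_ge0 ?sqr_ge0 ?ltW.
Qed.

Lemma trunc_lipschitz k d s t : 0 < d -> `|trunc k d s - trunc k d t| <= `|s - t|.
Proof.
move=> d0; rewrite /trunc.
set x := Num.max (s - k) 0; set y := Num.max (t - k) 0.
have x0 : 0 <= x by rewrite le_max lexx orbT.
have y0 : 0 <= y by rewrite le_max lexx orbT.
have truncE z : 0 <= z -> z ^+ 2 / (z + d) = z - d + d ^+ 2 / (z + d).
  by move=> z0; field; lra.
have xy : `|x - y| <= `|s - t|.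
  rewrite /x /y; case: (leP (s - k) 0) => ?; case: (leP (t - k) 0) => ?.
  - by rewrite subrr normr0.
  - by rewrite !ler0_norm; lra.
  - by rewrite !ger0_norm; lra.
  - by have -> : s - k - (t - k) = s - t by ring.
apply: le_trans xy.
have -> : x ^+ 2 / (x + d) - y ^+ 2 / (y + d) =
    (x - y) * (1 - d / (x + d) * (d / (y + d))).
  by rewrite !truncE//; field; lra.
have /andP[a0 a1] : 0 <= d / (x + d) <= 1 by rewrite ler_pdivrMr ?divr_ge0//=; lra.
have /andP[b0 b1] : 0 <= d / (y + d) <= 1 by rewrite ler_pdivrMr ?divr_ge0//=; lra.
rewrite normrM ler_piMr// ger0_norm; nra.
Qed.

(** Adding the Taylor bounds at [s] and at [t] cancels the values of [trunc] and leaves the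
    difference of slopes times [s - t]. *)
Lemma dtrunc_lipschitz k d s t : 0 < d ->
  `|dtrunc k d s - dtrunc k d t| <= 2 / d * `|s - t|.
Proof.
move=> d0; have [->|st] := eqVneq s t; first by rewrite !subrr normr0 mulr0.
have st0 : 0 < `|s - t| by rewrite normr_gt0 subr_eq0.
rewrite -(ler_pM2r st0) -normrM.
have -> : (dtrunc k d s - dtrunc k d t) * (s - t) =
    (trunc k d t - trunc k d s - dtrunc k d s * (t - s)) +
    (trunc k d s - trunc k d t - dtrunc k d t * (s - t)) by ring.
apply: le_trans (ler_normD _ _) _.
apply: le_trans (lerD (trunc_taylor k s t d0) (trunc_taylor k t s d0)) _.
have -> : (t - s) ^+ 2 / d + (s - t) ^+ 2 / d = 2 / d * (s - t) ^+ 2 by field; lra.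
by rewrite -[leRHS]mulrA -expr2 real_normK ?num_real.
Qed.

Lemma lipschitz_continuous (L : R) (h : R -> R) :
  (forall s t, `|h s - h t| <= L * `|s - t|) -> continuous h.
Proof.
move=> hL s; apply/cvgrPdist_lt => /= e e0; near=> t.
apply: le_lt_trans (hL s t) _.
have L1 : 0 < `|L| + 1 by rewrite ltr_wpDl.
apply: (@le_lt_trans _ _ ((`|L| + 1) * `|s - t|)).
  by rewrite ler_wpM2r// (le_trans (ler_norm _))// lerDl.
rewrite mulrC -ltr_pdivlMr//; near: t.
by apply: (@cvgr_dist_lt _ _ _ (nbhs s) _ id s); [exact: cvg_id|rewrite divr_gt0].
Unshelve. all: by end_near. Qed.

Lemma continuous_trunc k d : 0 < d -> continuous (trunc k d).
Proof.
move=> d0; apply: (@lipschitz_continuous 1) => s t.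
by rewrite mul1r trunc_lipschitz.
Qed.

Lemma continuous_dtrunc k d : 0 < d -> continuous (dtrunc k d).
Proof.
by move=> d0; apply: (@lipschitz_continuous (2 / d)) => s t; exact: dtrunc_lipschitz.
Qed.

End truncation.

(** * Directional derivatives of functions that need not be differentiable *)

Section directional_derivative.
Context {R : realType} {n : nat}.
Local Notation Rn := 'rV[R]_n.+1.
Implicit Types (psi : Rn -> R) (x e : Rn).

(* The limit of a divergent function is the dummy value 0, on both sides. *)
Lemma lim_approx_scale (F : set_system R) {FF : ProperFilter F} (A B : R -> R) (c : R) :
  (A h - c * B h) @[h --> F] --> 0 -> lim (A @ F) = c * lim (B @ F).
Proof.
move=> AB0.
have [cvB|ncvB] := pselect (cvg (B @ F)).
  apply: cvg_lim => //.
  have -> : A = (fun h => (A h - c * B h) + c * B h) by apply/funext => h; rewrite subrK.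
  by rewrite -[X in _ --> X]add0r; apply: cvgD => //; apply: cvgMr.
rewrite (dvgP ncvB) mulr0.
have [c0|c0] := eqVneq c 0.
  apply: cvg_lim => //; apply: cvg_trans AB0.
  by apply: near_eq_cvg; near=> h; rewrite c0 mul0r subr0.
rewrite dvgP// => cvA; apply: ncvB.
have -> : B = (fun h => c^-1 * (A h - (A h - c * B h))).
  by apply/funext => h; rewrite opprB addrC subrK mulKf.
by apply: is_cvgMr; apply: is_cvgB => //; apply/cvg_ex; exists 0.
Unshelve. all: by end_near. Qed.

Lemma near0_norm_lt (r : R) : 0 < r -> \forall h \near (0 : R)^', `|h| < r.
Proof.
move=> r0; apply: cvg_within; exists r => //= h.
by rewrite /ball_/= sub0r normrN.
Qed.

(** The Lipschitz bound makes the Taylor remainder at most [L ^+ 2 * h ^+ 2 / d], so the quotient of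
    the composition and the scaled quotient of [psi] differ by o(1), whether or not they
    converge. *)
Lemma derive_trunc psi x e (k d L : R) : 0 < d ->
  (\forall h \near (0 : R)^', `|psi (h *: e + x) - psi x| <= L * `|h|) ->
  'D_e (trunc k d \o psi) x = dtrunc k d (psi x) * 'D_e psi x.
Proof.
move=> d0 psiL; rewrite /derive.
apply: lim_approx_scale => /=.
apply/cvgrPdist_le => /= eps eps0.
have d0' : (0 : R)^' [set h | `|h| <= eps * d / (L ^+ 2 + 1)].
  have : 0 < eps * d / (L ^+ 2 + 1).
    by rewrite divr_gt0 ?mulr_gt0// ltr_wpDl ?sqr_ge0.
  by move=> /near0_norm_lt; apply: filterS => h /ltW.
near=> h.
have h0 : h != 0 by near: h; exact: nbhs_dnbhs_neq.
rewrite sub0r normrN /GRing.scale/= mulrCA -mulrBr normrM.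
have hL : `|psi (h *: e + x) - psi x| <= L * `|h| by near: h.
apply: le_trans (ler_wpM2l (normr_ge0 _) (trunc_taylor _ _ _ d0)) _.
have -> : (psi (h *: e + x) - psi x) ^+ 2 = `|psi (h *: e + x) - psi x| ^+ 2.
  by rewrite real_normK ?num_real.
have L0 : 0 <= L * `|h| by exact: le_trans hL.
have hp : 0 < `|h| by rewrite normr_gt0.
have hd : `|h| <= eps * d / (L ^+ 2 + 1) by near: h.
apply: (@le_trans _ _ (`|h^-1| * ((L * `|h|) ^+ 2 / d))).
  rewrite ler_wpM2l// ler_wpM2r//; first by rewrite invr_ge0 ltW.
  by rewrite ler_sqr ?nnegrE.
rewrite normrV ?unitfE//.
have -> : `|h|^-1 * ((L * `|h|) ^+ 2 / d) = L ^+ 2 * `|h| / d by field; rewrite !gt_eqF.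
rewrite ler_pdivrMr//.
have L1 : 0 < L ^+ 2 + 1 by rewrite ltr_wpDl ?sqr_ge0.
move: hd; rewrite ler_pdivlMr// => hd.
by apply: le_trans hd; rewrite mulrC ler_wpM2l// ltW// ltrDl.
Unshelve. all: by end_near. Qed.

Definition diff_quot psi e (h : R) : Rn -> R := fun x => h^-1 * (psi (h *: e + x) - psi x).

Lemma continuous_diff_quot psi e h : continuous psi -> continuous (diff_quot psi e h).
Proof.
move=> cpsi x; rewrite /diff_quot.
apply: (@cvgMl_tmp _ _ (nbhs x) (@nbhs_filter _ x)).
apply: (@cvgB _ _ _ (nbhs x) (@nbhs_filter _ x)); last exact: cpsi.
apply: (@continuous_comp _ _ _ (fun x => h *: e + x) psi); last exact: cpsi.
by apply: (@cvgD _ _ _ (nbhs x) (@nbhs_filter _ x)); [exact: cvg_cst|exact: cvg_id].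
Qed.

(* The points of convergence of the difference quotients form a countable
   intersection of countable unions of closed sets. *)
Lemma measurable_derive psi e (D : set Rn) : measurable D -> continuous psi ->
  measurable_fun D (fun x => 'D_e psi x).
Proof.
move=> mD cpsi.
pose q := diff_quot psi e.
pose osc m l : set Rn := [set x | forall h h', h != 0 -> h' != 0 ->
  `|h| < l.+1%:R^-1 -> `|h'| < l.+1%:R^-1 -> `|q h x - q h' x| <= m.+1%:R^-1].
pose K := \bigcap_m \bigcup_l osc m l.
have mK : measurable K.
  apply: bigcapT_measurable => m; apply: bigcupT_measurable => l.
  apply: rV_closed_measurable.
  (* For a fixed pair of increments the condition is closed in [x], and closedness survives this
     uncountable intersection. *)
  have -> : osc m l = \bigcap_(hh in [set hh : R * R | [/\ hh.1 != 0, hh.2 != 0,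
      `|hh.1| < l.+1%:R^-1 & `|hh.2| < l.+1%:R^-1]])
      [set x | `|q hh.1 x - q hh.2 x| <= m.+1%:R^-1].
    apply/seteqP; split => [x ox [h h'] [/= h0 h0' hl hl']|x ox h h' h0 h0' hl hl'].
      exact: ox.
    by apply: (ox (h, h')).
  apply: closed_bigI => -[h h'] _ /=.
  apply: (@closed_comp _ _ (fun x => `|q h x - q h' x|) [set y : R | y <= m.+1%:R^-1]).
    move=> x _; apply: (@continuous_comp _ _ _ (fun x => q h x - q h' x) Num.norm).
      by apply: (@cvgB _ _ _ (nbhs x) (@nbhs_filter _ x)); exact: continuous_diff_quot.
    exact: norm_continuous.
  exact: closed_le.
have KP x : K x <-> cvg (q^~ x @ 0^').
  rewrite -(cauchy_cvgP (q^~ x @ 0^')) -cauchy_ballP; split.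
    move=> Kx eps eps0.
    have [m me] : exists m : nat, m.+1%:R^-1 < eps.
      by have [m _ /(_ m (leqnn m))] := near_infty_natSinv_lt (PosNum eps0); exists m.
    have [l _ ox] := Kx m I.
    pose P := q^~ x @` [set h | h != 0 /\ `|h| < l.+1%:R^-1].
    have FP : (q^~ x @ 0^') P.
      have : \forall h \near (0:R)^', h != 0 /\ `|h| < l.+1%:R^-1.
        near=> h; split; first by near: h; exact: nbhs_dnbhs_neq.
        by near: h; exact: near0_norm_lt.
      by apply: filterS => h [h0 hl]; exists h.
    exists (P, P) => // -[y y'] [[h [h0 hl] <-] [h' [h0' hl'] <-]] /=.
    by apply: le_lt_trans me; exact: ox.
  move=> cq m _.
  have /cq[[P P'] [/= FP FP'] PP] : 0 < m.+1%:R^-1 :> R by [].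
  have : (0:R)^' [set h | P (q h x) /\ P' (q h x)] by apply: filterI.
  rewrite /dnbhs /within /= => /nbhs_ballP[r /= r0 rP].
  have [l lr] : exists l : nat, l.+1%:R^-1 < r.
    by have [l _ /(_ l (leqnn l))] := near_infty_natSinv_lt (PosNum r0); exists l.
  exists l => // h h' h0 h0' hl hl'.
  have [|Ph _] := rP h _ h0; first by rewrite /ball/= sub0r normrN (lt_trans hl).
  have [|_ Ph'] := rP h' _ h0'; first by rewrite /ball/= sub0r normrN (lt_trans hl').
  by apply/ltW; apply: (PP (q h x, q h' x)).
rewrite -(setUIDK D K); apply/measurable_funU; [exact: measurableI|exact: measurableD|].
split.
  (* On [K] the limit exists, so a single sequence of increments computes it. *)
  apply: (@measurable_fun_cvg _ _ _ _ (fun l => q l.+1%:R^-1)) => [l|x [_ /KP cq]].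
    apply: rV_continuous_measurable; first exact: measurableI.
    exact: continuous_diff_quot.
  apply: (@cvg_comp _ _ _ (fun l => l.+1%:R^-1) (q^~ x) _ (0:R)^'); last exact: cq.
  move=> A [r /= r0 rA]; have [l _ lr] := near_infty_natSinv_lt (PosNum r0).
  exists l => // j /= lj; apply: rA; last by rewrite invr_neq0.
  by rewrite /ball_/= sub0r normrN ger0_norm//; exact: lr.
(* Off [K] the derivative is the dummy value 0. *)
have : measurable_fun (D `\` K) (fun=> 0 : R) by exact: measurable_cst.
apply: eq_measurable_fun => x; rewrite inE => -[_ nKx].
by rewrite /derive dvgP//; apply: contra_not nKx => cq; exact/KP.
Unshelve. all: by end_near. Qed.

End directional_derivative.

Section lip0.
Context {R : realType} {n : nat}.
Local Notation Rn := 'rV[R]_n.+1.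
Implicit Types (psi : Rn -> R) (x e : Rn) (Omega : set Rn).

Lemma Lip0_locally_lipschitz Omega psi x : Lip0 Omega psi -> Omega x ->
  exists2 L : R, 0 < L &
    nbhs (x, x) [set y : Rn * Rn | `|psi y.1 - psi y.2| <= L * `|y.1 - y.2|].
Proof.
case=> + _ _ Ox => /(_ x Ox) -[M [_ ML]].
exists (`|M| + 1); first by rewrite ltr_wpDl.
by apply: ML; rewrite (le_lt_trans (ler_norm _))// ltrDl.
Qed.

Lemma Lip0_continuous Omega psi : Lip0 Omega psi -> continuous psi.
Proof.
move=> lpsi x; have [Ox|nOx] := pselect (Omega x).
  have [L L0 Lx] := Lip0_locally_lipschitz lpsi Ox.
  apply/(@cvgrPdist_lt _ _ _ _ (@nbhs_filter _ x)) => /= eps eps0.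
  have hx : \forall y \near x, `|psi x - psi y| <= L * `|x - y|.
    have c : (x, y) @[y --> x] --> (x, x) 
      by apply: (@cvg_pair _ _ _ _ _ _ (@nbhs_filter _ x) (@nbhs_filter _ x) (@nbhs_filter _ x));
        [exact: (@cvg_cst _ _ _ _ (@nbhs_filter _ x))|exact: cvg_id].
    exact: c Lx.
  have hy : \forall y \near x, `|x - y| < eps / L.
    by apply: (@cvgr_dist_lt _ _ _ (nbhs x) (@nbhs_filter _ x) id x); [exact: cvg_id|rewrite divr_gt0].
  apply: (@filterS2 _ _ (@nbhs_filter _ x) _ _ _ _ hx hy) => y xy1 xy2.
  by apply: (le_lt_trans xy1); rewrite mulrC -ltr_pdivlMr.
(* A point outside [Omega] is off the closed support, so [psi] vanishes in a whole neighbourhood of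
   it. *)
case: lpsi => _ _ suppO.
have nx : nbhs x (~` closure [set x | psi x != 0]).
  by apply: open_nbhs_nbhs; split; [exact/closed_openC/closed_closure|move/suppO].
have psi0 y : ~ closure [set x | psi x != 0] y -> psi y = 0.
  by move=> ncy; apply/eqP; apply: contra_notT ncy => ?; exact: subset_closure.
rewrite /continuous_at; have -> : psi x = 0 by apply: psi0 => /suppO.
apply: (@cvg_trans _ (0 @[y --> x])); last first.
  exact: (@cvg_cst _ _ _ _ (@nbhs_filter _ x)).
by apply: (@near_eq_cvg _ _ _ (@nbhs_filter _ x)); apply: (@filterS _ _ (@nbhs_filter _ x) _ _ _ nx) => y /psi0 ->.
Qed.

(** With [0 <= k] the truncation vanishes wherever [psi] does, so the support does not grow. *)
Lemma Lip0_trunc Omega psi k d : 0 < d -> 0 <= k -> Lip0 Omega psi ->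
  Lip0 Omega (trunc k d \o psi).
Proof.
move=> d0 k0 lpsi.
have supp : [set x | (trunc k d \o psi) x != 0] `<=` [set x | psi x != 0].
  by move=> x /=; apply: contra => /eqP ->; rewrite trunc_le.
have csupp := closure_subset supp.
split.
- move=> x Ox; have [L L0 Lx] := Lip0_locally_lipschitz lpsi Ox.
  exists L; split; first exact: num_real.
  move=> M LM; apply: filterS Lx => y /= yL.
  apply: le_trans (trunc_lipschitz _ _ _ d0) _; apply: le_trans yL _.
  by rewrite ler_wpM2r// ltW.
- case: lpsi => _ cpsi _; apply: subclosed_compact cpsi _ => //.
  exact: closed_closure.
- by case: lpsi => _ _; exact: subset_trans.
Qed.

Lemma grad_trunc Omega psi k d x : 0 < d -> Lip0 Omega psi -> Omega x ->
  grad (trunc k d \o psi) x = dtrunc k d (psi x) *: grad psi x.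
Proof.
move=> d0 lpsi Ox; apply/matrixP => i j; rewrite !mxE.
have [L L0 Lx] := Lip0_locally_lipschitz lpsi Ox.
set e : Rn := delta_mx ord0 i.
apply: (@derive_trunc _ _ _ _ _ _ _ (L * `|e|)) => //.
have c : (h *: e + x, x) @[h --> (0 : R)^'] --> (x, x).
  apply: (@cvg_pair _ _ _ _ _ _ _ (@nbhs_filter _ x) (@nbhs_filter _ x)); last exact: cvg_cst.
  have -> : nbhs x = nbhs ((0 : R) *: e + x) by rewrite scale0r add0r.
  apply: cvgD; last exact: cvg_cst.
  by apply: cvgZr_tmp; exact: cvg_within.
have : \forall h \near (0 : R)^', `|psi (h *: e + x) - psi x| <= L * `|h *: e + x - x|.
  exact: c Lx.
by apply: filterS => h; rewrite addrK normrZ mulrA mulrAC.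
Qed.

Lemma measurable_grad Omega psi (D : set Rn) : measurable D -> Lip0 Omega psi ->
  measurable_field D (grad psi).
Proof.
move=> mD /Lip0_continuous cpsi i.
have : measurable_fun D (fun x => 'D_(delta_mx ord0 i) psi x) by exact: measurable_derive.
by apply: eq_measurable_fun => x _; rewrite mxE.
Qed.

End lip0.

Section measurable_fields.
Context {d} {T : measurableType d} {R : realType} {n : nat}.
Implicit Types (D : set T) (F G : T -> 'cV[R]_n.+1) (Q : T -> 'M[R]_n.+1).

Lemma measurable_dot D F G :
  (forall i, measurable_fun D (fun x => F x i ord0)) ->
  (forall i, measurable_fun D (fun x => G x i ord0)) ->
  measurable_fun D (fun x => dot (F x) (G x)).
Proof.
move=> mF mG; apply: measurable_sum => i.
by apply: measurable_funM; [exact: mF|exact: mG].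
Qed.

Lemma measurable_fieldB D F G :
  (forall i, measurable_fun D (fun x => F x i ord0)) ->
  (forall i, measurable_fun D (fun x => G x i ord0)) ->
  forall i, measurable_fun D (fun x => (F x - G x) i ord0).
Proof.
move=> mF mG i.
by apply: eq_measurable_fun (measurable_funB (mF i) (mG i)) => x _; rewrite /= !mxE.
Qed.

Lemma measurable_mulmx D Q F :
  (forall i j, measurable_fun D (fun x => Q x i j)) ->
  (forall i, measurable_fun D (fun x => F x i ord0)) ->
  forall i, measurable_fun D (fun x => (Q x *m F x) i ord0).
Proof.
move=> mQ mF i.
have : measurable_fun D (fun x => \sum_j Q x i j * F x j ord0).
  apply: measurable_sum => j.
  by apply: measurable_funM; [exact: mQ|exact: mF].
by apply: eq_measurable_fun => x _; rewrite mxE.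
Qed.

(** [sqrtmx (Q x)] is chosen point by point, so measurability is read off from the square of the
    norm, which is the quadratic form of [Q x]. *)
Lemma measurable_enorm_sqrtmx D Q F :
  (forall i j, measurable_fun D (fun x => Q x i j)) ->
  (forall x, D x -> (Q x)^T = Q x /\ nonneg_def (Q x)) ->
  (forall i, measurable_fun D (fun x => F x i ord0)) ->
  measurable_fun D (fun x => enorm (sqrtmx (Q x) *m F x)).
Proof.
move=> mQ Qsym mF.
have mFQF := measurable_dot mF (measurable_mulmx mQ mF).
have := measurableT_comp (@measurable_powR R 2^-1) mFQF.
apply: eq_measurable_fun => x; rewrite inE => /Qsym[Qs Qn] /=.
by rewrite powR12_sqrt ?Qn// dot_sqrtmx.
Qed.

End measurable_fields.

(** * Integral and Orlicz estimates *)

Section integral_inequalities.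
Context {d} {T : measurableType d} {R : realType}.
Context (mu : {measure set T -> \bar R}) (D : set T) (mD : measurable D).
Implicit Types (F G h w : T -> R).

Lemma le_integral_lin (h h1 h2 : T -> R) (c1 c2 A1 A2 : R) :
  measurable_fun D h -> measurable_fun D h1 -> measurable_fun D h2 ->
  (forall x, D x -> 0 <= h x) -> (forall x, D x -> 0 <= h1 x) ->
  (forall x, D x -> 0 <= h2 x) -> 0 <= c1 -> 0 <= c2 ->
  (forall x, D x -> h x <= c1 * h1 x + c2 * h2 x) ->
  (\int[mu]_(x in D) (h1 x)%:E <= A1%:E)%E ->
  (\int[mu]_(x in D) (h2 x)%:E <= A2%:E)%E ->
  (\int[mu]_(x in D) (h x)%:E <= (c1 * A1 + c2 * A2)%:E)%E.
Proof.
move=> mh mh1 mh2 h0 h10 h20 c10 c20 hle i1 i2.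
have m1 : measurable_fun D (EFin \o h1) by exact/measurable_EFinP.
have m2 : measurable_fun D (EFin \o h2) by exact/measurable_EFinP.
have mc1 : measurable_fun D (fun x => c1%:E * (h1 x)%:E)%E.
  by apply: emeasurable_funM => //; exact: measurable_cst.
have mc2 : measurable_fun D (fun x => c2%:E * (h2 x)%:E)%E.
  by apply: emeasurable_funM => //; exact: measurable_cst.
apply: (@le_trans _ _ (\int[mu]_(x in D) (c1%:E * (h1 x)%:E + c2%:E * (h2 x)%:E))%E).
  apply: ge0_le_integral => //.
  - exact/measurable_EFinP.
  - exact: emeasurable_funD.
have p10 x : D x -> (0 <= (h1 x)%:E)%E by move=> Dx; rewrite lee_fin h10.
have p20 x : D x -> (0 <= (h2 x)%:E)%E by move=> Dx; rewrite lee_fin h20.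
have pc1 x : D x -> (0 <= c1%:E * (h1 x)%:E)%E by move=> Dx; rewrite mule_ge0// p10.
have pc2 x : D x -> (0 <= c2%:E * (h2 x)%:E)%E by move=> Dx; rewrite mule_ge0// p20.
rewrite ge0_integralD// !ge0_integralZl_EFin//.
by rewrite EFinD !EFinM; apply: leeD; apply: lee_wpmul2l; rewrite ?lee_fin.
Qed.

Lemma le_integral_scale (h h1 : T -> R) (c A : R) :
  measurable_fun D h -> measurable_fun D h1 ->
  (forall x, D x -> 0 <= h x) -> (forall x, D x -> 0 <= h1 x) -> 0 <= c ->
  (forall x, D x -> h x <= c * h1 x) ->
  (\int[mu]_(x in D) (h1 x)%:E <= A%:E)%E ->
  (\int[mu]_(x in D) (h x)%:E <= (c * A)%:E)%E.
Proof.
move=> mh mh1 h0 h10 c0 hle i1.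
have -> : c * A = c * A + 0 * A by rewrite mul0r addr0.
apply: (@le_integral_lin _ h1 h1) => //.
by move=> x Dx; rewrite mul0r addr0 hle.
Qed.

Lemma measurable_fun_powR h (p : R) : measurable_fun D h ->
  measurable_fun D (fun x => h x `^ p).
Proof. by move=> mh; exact: (measurableT_comp (@measurable_powR R p) mh). Qed.

(** Young's inequality for [F / al] and [G / be], integrated. Positive upper bounds in place of the
    norms avoid the cases of a zero or infinite norm. *)
Lemma hoelder_bound F G w (p q al be : R) : 0 < p -> 0 < q -> p^-1 + q^-1 = 1 ->
  0 < al -> 0 < be ->
  measurable_fun D F -> measurable_fun D G -> measurable_fun D w ->
  (forall x, D x -> 0 <= F x) -> (forall x, D x -> 0 <= G x) ->
  (forall x, D x -> 0 <= w x) ->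
  (\int[mu]_(x in D) (F x `^ p * w x)%:E <= (al `^ p)%:E)%E ->
  (\int[mu]_(x in D) (G x `^ q * w x)%:E <= (be `^ q)%:E)%E ->
  (\int[mu]_(x in D) (F x * G x * w x)%:E <= (al * be)%:E)%E.
Proof.
move=> p0 q0 pq al0 be0 mF mG mw F0 G0 w0 iF iG.
have alp : 0 < al `^ p by rewrite powR_gt0.
have beq : 0 < be `^ q by rewrite powR_gt0.
have -> : al * be = al * be / p / al `^ p * al `^ p + al * be / q / be `^ q * be `^ q.
  by rewrite !divfK ?gt_eqF// -mulrDr pq mulr1.
apply: le_integral_lin iF iG.
- by apply: measurable_funM => //; exact: measurable_funM.
- by apply: measurable_funM => //; exact: measurable_fun_powR.
- by apply: measurable_funM => //; exact: measurable_fun_powR.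
- by move=> x Dx; rewrite !mulr_ge0 ?F0 ?G0 ?w0.
- by move=> x Dx; rewrite mulr_ge0 ?powR_ge0 ?w0.
- by move=> x Dx; rewrite mulr_ge0 ?powR_ge0 ?w0.
- by rewrite !mulr_ge0 ?invr_ge0 ?powR_ge0 ?ltW.
- by rewrite !mulr_ge0 ?invr_ge0 ?powR_ge0 ?ltW.
move=> x Dx; rewrite !mulrA -mulrDl ler_wpM2r ?w0//.
have a0 : 0 <= F x / al by rewrite divr_ge0 ?F0 ?ltW.
have b0 : 0 <= G x / be by rewrite divr_ge0 ?G0 ?ltW.
have inv (y z r : R) : 0 <= y -> 0 < z -> (y / z) `^ r = y `^ r / z `^ r.
  move=> y0 /ltW z0; rewrite powRM ?invr_ge0//.
  by rewrite -(powR_inv1 z0) -powRrM mulN1r powRN.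
have := conjugate_powR a0 b0 p0 q0 pq; rewrite !inv ?F0 ?G0// => young.
have := ler_wpM2l (ltW (mulr_gt0 al0 be0)) young.
have -> : al * be * (F x / al * (G x / be)) = F x * G x by field; rewrite !gt_eqF.
move=> /le_trans; apply; rewrite le_eqVlt; apply/orP; left; apply/eqP.
by field; rewrite !gt_eqF.
Qed.

End integral_inequalities.

(** * Logarithmic growth and summation of the level increments *)

Section log_estimates.
Context {R : realType}.

Lemma powR_expR (a s : R) : expR a `^ s = expR (s * a).
Proof. by rewrite /powR gt_eqF ?expR_gt0// expRK. Qed.

Lemma ln_le_subr1 (x : R) : 0 < x -> ln x <= x - 1.
Proof.
move=> x0; have := @le_ln1Dx R (x - 1).
by rewrite (_ : 1 + (x - 1) = x); [apply; lra|ring].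
Qed.

(** Linear growth beats the logarithm. The exponential inside is the threshold at which
    [orlicz_tail] splits its set. *)
Lemma ln_expR1D_ge (b r : R) : 0 < b -> 0 <= r -> exists2 c : R, 0 < c &
  forall y, 0 <= y -> c * (1 + y) <= ln (expR 1 + expR (b * y - r * ln (1 + y))).
Proof.
(* [K] makes [r / K <= b / 2], so that [ln z < z] at [z = (1 + y) / K] lets half of the linear term
   absorb the logarithm. *)
move=> b0 r0; pose K := 2 * r / b + 1.
have rb0 : 0 <= 2 * r / b by rewrite divr_ge0 ?mulr_ge0// ltW.
have K1 : 1 <= K by rewrite lerDr.
have lnK : 0 <= ln K by rewrite ln_ge0.
have rK : r / K <= b / 2.
  rewrite ler_pdivrMr; last by lra.
  by rewrite /K mulrDr (_ : b / 2 * (2 * r / b) = r); [lra|field; lra].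
pose D := b + r * ln K.
have D0 : 0 < D by rewrite ltr_pwDl// mulr_ge0.
exists (Num.min (b / 4) (b / (4 * D))).
  by rewrite lt_min !divr_gt0// mulr_gt0.
move=> y y0; set t := b * y - _.
have y1 : 0 < 1 + y by lra.
have tD : b / 2 * (1 + y) - D <= t.
  have : ln ((1 + y) / K) <= (1 + y) / K.
    by apply/ltW/ln_sublinear; rewrite divr_gt0//; lra.
  rewrite lnM ?posrE ?invr_gt0//; last by lra.
  rewrite lnV ?posrE; last by lra.
  move=> lnle; have : r * ln (1 + y) <= r * ((1 + y) / K + ln K).
    by rewrite ler_wpM2l//; lra.
  have : r / K * (1 + y) <= b / 2 * (1 + y) by rewrite ler_wpM2r ?(ltW y1).
  by rewrite /t /D; lra.
have ln1 : 1 <= ln (expR 1 + expR t).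
  by rewrite -[leLHS]expRK ler_ln ?posrE ?addr_gt0 ?expR_gt0// lerDl expR_ge0.
have lnt : t <= ln (expR 1 + expR t).
  by rewrite -[leLHS]expRK ler_ln ?posrE ?addr_gt0 ?expR_gt0// lerDr expR_ge0.
(* For large [y] the bound comes from [lnt]; otherwise [1 + y] is bounded and [ln1] suffices. *)
have [h|h] := leP D (b / 4 * (1 + y)).
  apply: (@le_trans _ _ (b / 4 * (1 + y))).
    by rewrite ler_wpM2r ?(ltW y1)// ge_min lexx.
  by lra.
apply: le_trans ln1; apply: (@le_trans _ _ (b / (4 * D) * (1 + y))).
  by rewrite ler_wpM2r ?(ltW y1)// ge_min lexx orbT.
have -> : b / (4 * D) * (1 + y) = b / 4 * (1 + y) / D by field; lra.
by rewrite ler_pdivrMr// mul1r ltW.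
Qed.

Lemma powR_telescope (a j : R) : 1 < a -> 0 <= j ->
  (a - 1) * 2 `^ (- a) * (1 + j) `^ (- a) <= (1 + j) `^ (- (a - 1)) - (2 + j) `^ (- (a - 1)).
Proof.
move=> a1 j0; set b := a - 1; have b0 : 0 < b by rewrite /b; lra.
have x0 : 0 < 1 + j by lra.
have y0 : 0 < 2 + j by lra.
have z0 : 0 < (1 + j) / (2 + j) by rewrite divr_gt0.
have -> : (1 + j) `^ (- b) = (2 + j) `^ (- b) * expR (- b * ln ((1 + j) / (2 + j))).
  rewrite /powR !gt_eqF// -expRD lnM ?posrE ?invr_gt0// lnV ?posrE//.
  by congr expR; ring.
rewrite -[X in _ <= _ - X]mulr1 -mulrBr.
have -> : a = b + 1 by rewrite /b subrK.
apply: (@le_trans _ _ ((2 + j) `^ (- b) * (b / (2 + j)))).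
  have -> : (2 + j) `^ (- b) * (b / (2 + j)) = b * (2 + j) `^ (- (b + 1)).
    rewrite (_ : - (b + 1) = - b + - 1); last by ring.
    rewrite (@powRD _ (2 + j) (- b) (- 1)); last by apply/implyP => _; rewrite gt_eqF.
    by rewrite powR_inv1 ?ltW//; ring.
  rewrite -mulrA ler_wpM2l ?(ltW b0)// -powRM//; last by lra.
  rewrite !powRN lef_pV2 ?posrE ?powR_gt0 ?mulr_gt0//.
  by rewrite ge0_ler_powR ?nnegrE//; lra.
rewrite ler_wpM2l ?powR_ge0//.
have := expR_ge1Dx (- b * ln ((1 + j) / (2 + j))).
have : b * ln ((1 + j) / (2 + j)) <= b * ((1 + j) / (2 + j) - 1).
  by rewrite ler_wpM2l ?(ltW b0)// ln_le_subr1.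
have -> : (1 + j) / (2 + j) - 1 = - (1 / (2 + j)) by field; lra.
have -> : b / (2 + j) = b * (1 / (2 + j)) by field; lra.
move: (1 / _) (ln _) (expR _) => u l e h1 h2; lra.
Qed.

Lemma degiorgi_iteration (m : R -> \bar R) (a M K : R) : 1 < a -> 0 < K ->
  {homo m : x y / x <= y >-> (y <= x)%E} -> (m 0%R <= M%:E)%E ->
  (forall (j : nat) (k : R), 0 <= k -> (m k <= (M * expR (- j%:R))%:E)%E ->
     (m (k + K * (1 + j%:R) `^ (- a))%R <= (M * expR (- j.+1%:R))%:E)%E) ->
  (m (K * 2 `^ a / (a - 1))%R <= 0)%E.
Proof.
move=> a1 K0 mle m0 step; set B := K * _ / _.
have a10 : 0 < a - 1 by lra.
have B0 : 0 < B by rewrite /B divr_gt0// mulr_gt0// powR_gt0.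
(* Levels in closed form rather than partial sums: they start at 0, stay below [B], and by
   telescoping each gap contains the increment required by [step]. *)
pose k (j : nat) := B * (1 - (1 + j%:R) `^ (- (a - 1))).
have k0 j : 0 <= k j.
  have p1 : 1 <= (1 + j%:R) `^ (a - 1) :> R.
    by rewrite -[leLHS](powRr0 (1 + j%:R)); apply: ler_powR; rewrite ?lerDl// ltW.
  by rewrite mulr_ge0 ?(ltW B0)// subr_ge0 powRN invf_le1// (lt_le_trans _ p1).
have kS j : k j + K * (1 + j%:R) `^ (- a) <= k j.+1.
  have := powR_telescope a1 (ler0n R j).
  rewrite /k (_ : 1 + j.+1%:R = 2 + j%:R :> R); last by rewrite -addn1 natrD; ring.
  move=> /(ler_wpM2l (ltW B0)).
  have -> : B * ((a - 1) * 2 `^ (- a) * (1 + j%:R) `^ (- a)) = K * (1 + j%:R) `^ (- a).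
    by rewrite /B powRN; field; rewrite !gt_eqF// powR_gt0.
  lra.
have mk j : (m (k j) <= (M * expR (- j%:R))%:E)%E.
  elim: j => [|j ih].
    by rewrite /k addr0 powR1 subrr mulr0 oppr0 expR0 mulr1.
  by apply: le_trans (step j _ (k0 j) ih); exact: mle.
have M0 : 0 < expR 0 :> R by rewrite expR_gt0.
apply/lee_addgt0Pr => e e0; rewrite add0e.
have [j Mj] : exists j : nat, M * expR (- j%:R) <= e.
  have := archi_boundP (divr_ge0 (normr_ge0 M) (ltW e0)).
  set n := Num.bound _ => nM; exists n.
  rewrite expRN ler_pdivrMr ?expR_gt0//.
  apply: (@le_trans _ _ (e * n%:R)).
    apply: (le_trans (ler_norm _)); rewrite mulrC -ler_pdivrMr// ltW//.
  rewrite ler_wpM2l ?(ltW e0)//.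
  by have := expR_ge1Dx (n%:R : R); lra.
apply: (@le_trans _ _ (M * expR (- j%:R))%:E); last by rewrite lee_fin.
apply: le_trans (mk j); apply: mle.
by rewrite /k ler_piMr ?(ltW B0)// gerBl powR_ge0.
Qed.

End log_estimates.

Section orlicz_tail.
Context {d} {T : measurableType d} {R : realType}.
Context (mu : {measure set T -> \bar R}).

Lemma orlicz_tail (P Q r M : R) : 0 < r -> r < P -> 0 <= Q -> 0 < M ->
  exists2 C : R, 0 < C & forall (E : set T) (w h : T -> R) (y : R),
    measurable E -> measurable_fun E w -> measurable_fun E h ->
    (forall x, E x -> 0 <= w x) -> (forall x, E x -> 0 <= h x) -> 0 <= y ->
    (\int[mu]_(x in E) (w x)%:E <= (M * expR (- y))%:E)%E ->
    (\int[mu]_(x in E) (h x `^ P * ln (expR 1 + h x) `^ Q * w x)%:E <= 1)%E ->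
    (\int[mu]_(x in E) (h x `^ r * w x)%:E <=
      (C * expR (- (y * (1 - r / P)) - Q * r / P * ln (1 + y)))%:E)%E.
Proof.
move=> r0 rP Q0 M0; have P0 : 0 < P by exact: lt_trans rP.
have [c c0 clog] : exists2 c : R, 0 < c & forall y, 0 <= y ->
    c * (1 + y) <= ln (expR 1 + expR (P^-1 * y - Q / P * ln (1 + y))).
  by apply: ln_expR1D_ge; [rewrite invr_gt0|rewrite divr_ge0// ltW].
have cQ0 : 0 < c `^ (- Q) by rewrite powR_gt0.
exists (M + c `^ (- Q)); first by rewrite addr_gt0.
move=> E w h y mE mw mh w0 h0 y0 iw ih.
set l := ln (1 + y); pose tau := P^-1 * y - Q / P * l; pose t := expR tau.
have t0 : 0 < t by rewrite expR_gt0.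
have y1 : 0 < 1 + y by lra.
have lnp s : 0 <= s -> 1 <= ln (expR 1 + s) :> R.
  by move=> s0; rewrite -[leLHS]expRK ler_ln ?posrE ?ltr_wpDr ?expR_gt0// lerDl.
have mlog : measurable_fun E (fun x => ln (expR 1 + h x)).
  apply: (measurableT_comp (@measurable_ln R)).
  by apply: measurable_funD => //; exact: measurable_cst.
(* Split E according to whether h exceeds t, chosen so that the two parts
   contribute terms of the same order. *)
have main : (\int[mu]_(x in E) (h x `^ r * w x)%:E <= (t `^ r * (M * expR (- y)) +
    t `^ (r - P) * ln (expR 1 + t) `^ (- Q) * 1)%:E)%E.
  apply: le_integral_lin iw ih => //.
  - by apply: measurable_funM => //; exact: measurable_fun_powR.
  - apply: measurable_funM => //; apply: measurable_funM => //; exact: measurable_fun_powR.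
  - by move=> x Ex; rewrite mulr_ge0 ?powR_ge0 ?w0.
  - by move=> x Ex; rewrite !mulr_ge0 ?powR_ge0 ?w0.
  - exact: powR_ge0.
  - by rewrite mulr_ge0 ?powR_ge0.
  move=> x Ex; rewrite mulrA -mulrDl ler_wpM2r ?w0//.
  have [ht|th] := leP (h x) t.
    rewrite -[leLHS]addr0 lerD//; last by rewrite !mulr_ge0 ?powR_ge0.
    by rewrite ge0_ler_powR ?nnegrE ?h0 ?(ltW r0) ?(ltW t0).
  have hx0 : 0 < h x by exact: lt_trans th.
  rewrite -[leLHS]add0r lerD ?powR_ge0//.
  have -> : h x `^ r = h x `^ (r - P) * h x `^ P.
    by rewrite -powRD ?subrK//; apply/implyP => _; rewrite gt_eqF.
  have -> : t `^ (r - P) * ln (expR 1 + t) `^ (- Q) * (h x `^ P * ln (expR 1 + h x) `^ Q) =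
     t `^ (r - P) * h x `^ P * (ln (expR 1 + t) `^ (- Q) * ln (expR 1 + h x) `^ Q) by ring.
  have Lt : 1 <= ln (expR 1 + t) by exact/lnp/ltW.
  have Lt0 : 0 < ln (expR 1 + t) by exact: lt_le_trans Lt.
  have Lh : ln (expR 1 + t) <= ln (expR 1 + h x).
    by rewrite ler_ln ?posrE ?addr_gt0 ?expR_gt0// lerD2l ltW.
  apply: (@le_trans _ _ (t `^ (r - P) * h x `^ P)).
    rewrite ler_wpM2r ?powR_ge0// -opprB !powRN lef_pV2 ?posrE ?powR_gt0//.
    by rewrite ge0_ler_powR ?nnegrE ?subr_ge0 ?ltW.
  rewrite ler_peMr ?mulr_ge0 ?powR_ge0//.
  rewrite powRN ler_pdivlMl ?powR_gt0// mulr1.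
  by rewrite ge0_ler_powR ?nnegrE// ltW// (lt_le_trans Lt0).
apply: (le_trans main); rewrite lee_fin mulr1.
have cy0 : 0 < c * (1 + y) by rewrite mulr_gt0.
have Lc : ln (expR 1 + t) `^ (- Q) <= (c * (1 + y)) `^ (- Q).
  have cl := clog y y0.
  rewrite !powRN lef_pV2 ?posrE ?powR_gt0//; last exact: lt_le_trans cl.
  by rewrite ge0_ler_powR ?nnegrE ?(ltW cy0)// ltW// (lt_le_trans cy0).
have e1 : t `^ (r - P) * (c * (1 + y)) `^ (- Q) =
    c `^ (- Q) * expR (- (y * (1 - r / P)) - Q * r / P * l).
  rewrite powRM ?ltW// /t powR_expR {2}/powR gt_eqF// -/l.
  rewrite [LHS]mulrCA -expRD; congr (_ * expR _).
  by rewrite /tau; field; lra.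
have e2 : t `^ r * (M * expR (- y)) = M * expR (- (y * (1 - r / P)) - Q * r / P * l).
  rewrite mulrCA /t powR_expR -expRD; congr (_ * expR _).
  by rewrite /tau; field; lra.
by rewrite e2 mulrDl lerD2l -e1 ler_wpM2l ?powR_ge0.
Qed.

End orlicz_tail.

(** * Energy estimate and decay of the superlevel sets *)

Section energy.
Context {d} {T : measurableType d} {R : realType}.
Context (mu : {measure set T -> \bar R}).
Implicit Types (D E : set T) (w h : T -> R).

Lemma integral_supported D E (h : T -> \bar R) : E `<=` D ->
  (forall x, D x -> ~ E x -> h x = 0%E) ->
  (\int[mu]_(x in D) h x = \int[mu]_(x in E) h x)%E.
Proof.
move=> ED h0; rewrite integral_mkcond [RHS]integral_mkcond; congr integral.
apply/funext => x; rewrite /patch.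
case: ifPn => Dx; case: ifPn => Ex //.
  by apply: h0; [exact: set_mem|move/mem_set; exact/negP].
by move: Ex => /set_mem/ED/mem_set; rewrite (negbTE Dx).
Qed.

Lemma ge0_le_EFin_integral D E h : measurable D -> measurable E -> E `<=` D ->
  measurable_fun D h -> (forall x, D x -> 0 <= h x) ->
  (\int[mu]_(x in E) (h x)%:E <= \int[mu]_(x in D) (h x)%:E)%E.
Proof.
move=> mD mE ED mh h0; apply: ge0_subset_integral => //.
exact/measurable_EFinP.
Qed.

Lemma chebyshev_bound D E w h (p c A : R) : measurable D -> measurable E -> E `<=` D ->
  measurable_fun D w -> measurable_fun D h ->
  (forall x, D x -> 0 <= w x) -> 0 < p -> 0 < c -> (forall x, E x -> c <= h x) ->
  (\int[mu]_(x in D) (h x `^ p * w x)%:E <= A%:E)%E ->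
  (\int[mu]_(x in E) (w x)%:E <= (A / c `^ p)%:E)%E.
Proof.
move=> mD mE ED mw mh w0 p0 c0 ch iA; rewrite mulrC.
have mhw : measurable_fun D (fun x => h x `^ p * w x).
  by apply: measurable_funM => //; exact: measurable_fun_powR.
apply: (@le_integral_scale _ _ _ mu E mE w (fun x => h x `^ p * w x)).
- exact: measurable_funS mw.
- exact: measurable_funS mhw.
- by move=> x /ED; exact: w0.
- by move=> x /ED Dx; rewrite mulr_ge0 ?powR_ge0 ?w0.
- by rewrite invr_ge0 powR_ge0.
- move=> x Ex; rewrite mulrA ler_peMl ?w0//; first exact: ED.
  rewrite mulrC ler_pdivlMr ?powR_gt0// mul1r.
  by rewrite ge0_ler_powR ?nnegrE ?(ltW p0) ?(ltW c0) ?(le_trans (ltW c0))// ch.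
- apply: le_trans iA; apply: ge0_le_EFin_integral => // x Dx.
  by rewrite mulr_ge0 ?powR_ge0 ?w0.
Qed.

Lemma integral_subsetU D E A B w (a b : R) : measurable D -> measurable E ->
  measurable A -> measurable B -> E `<=` A `|` B -> A `<=` D -> B `<=` D ->
  measurable_fun D w -> (forall x, D x -> 0 <= w x) ->
  (\int[mu]_(x in A) (w x)%:E <= a%:E)%E ->
  (\int[mu]_(x in B) (w x)%:E <= b%:E)%E ->
  (\int[mu]_(x in E) (w x)%:E <= (a + b)%:E)%E.
Proof.
move=> mD mE mA mB EAB AD BD mw w0 ia ib.
have ABD : A `|` B `<=` D by rewrite subUset.
have mAB := measurableU _ _ mA mB.
apply: (@le_trans _ _ (\int[mu]_(x in A `|` B) (w x)%:E)%E).
  apply: ge0_le_EFin_integral => //; first exact: measurable_funS mw.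
  by move=> x /ABD; exact: w0.
rewrite -(setDUK (@subsetUl _ A B)) ge0_integral_setU//.
- rewrite EFinD; apply: leeD => //; apply: le_trans ib.
  rewrite setDUl setDv set0U; apply: ge0_le_EFin_integral => //.
  + exact: measurableD.
  + exact: measurable_funS mw.
  + by move=> x /BD; exact: w0.
- exact: measurableD.
- rewrite setDUK; last exact: subsetUl.
  by apply/measurable_EFinP; exact: measurable_funS mw.
- by move=> x; rewrite setDUK => [/ABD/w0|]; [rewrite lee_fin|exact: subsetUl].
- by rewrite disj_set2E setDIK.
Qed.

(** Here [al] is the size of the given field, [be] that of the approximation error, and [s] their
    perturbed pairing. Pointwise, [c * al]^ p[exceeds the weak integrand by at most]al
    [^ (p - 1) * be], which Hoelder's inequality integrates. Integrability is included because the
    integrand changes sign. *)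
Lemma energy_lower D (al be s c : T -> R) (p W e : R) : measurable D -> 1 < p ->
  0 < W -> 0 < e ->
  measurable_fun D al -> measurable_fun D be -> measurable_fun D s ->
  measurable_fun D c ->
  (forall x, D x -> 0 <= al x) -> (forall x, D x -> 0 <= be x) ->
  (forall x, D x -> 0 <= c x <= 1) ->
  (forall x, D x -> al x ^+ 2 - al x * be x <= s x) ->
  (forall x, D x -> `|s x| <= al x ^+ 2 + al x * be x) ->
  (\int[mu]_(x in D) (al x `^ p)%:E <= (W `^ p)%:E)%E ->
  (\int[mu]_(x in D) (be x `^ p)%:E <= (e `^ p)%:E)%E ->
  mu.-integrable D (fun x => (al x `^ (p - 2) * (c x * s x))%:E) /\
  (\int[mu]_(x in D) (c x * al x `^ p)%:E <=
   \int[mu]_(x in D) (al x `^ (p - 2) * (c x * s x))%:E + (W `^ (p - 1) * e)%:E)%E.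
Proof.
move=> mD p1 W0 e0 mal mbe ms mc al0 be0 c01 sge sle ial ibe.
have p0 : 0 < p by lra.
have mL : measurable_fun D (fun x => al x `^ (p - 2) * (c x * s x)).
  by apply: measurable_funM; [exact: measurable_fun_powR|exact: measurable_funM].
have map : measurable_fun D (fun x => al x `^ p) by exact: measurable_fun_powR.
have mab : measurable_fun D (fun x => al x `^ (p - 1) * be x).
  by apply: measurable_funM => //; exact: measurable_fun_powR.
have mcp : measurable_fun D (fun x => c x * al x `^ p) by exact: measurable_funM.
have iab : (\int[mu]_(x in D) (al x `^ (p - 1) * be x)%:E <= (W `^ (p - 1) * e)%:E)%E.
  have := @hoelder_bound _ _ _ mu D mD (fun x => al x `^ (p - 1)) be (cst 1)
    (p / (p - 1)) p (W `^ (p - 1)) e.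
  have E1 : (\int[mu]_(x in D) (al x `^ (p - 1) * be x * cst 1 x)%:E =
             \int[mu]_(x in D) (al x `^ (p - 1) * be x)%:E)%E.
    by apply: eq_integral => x _; rewrite mulr1.
  have E2 : (\int[mu]_(x in D) ((al x `^ (p - 1)) `^ (p / (p - 1)) * cst 1 x)%:E =
             \int[mu]_(x in D) (al x `^ p)%:E)%E.
    apply: eq_integral => x _; rewrite mulr1 -powRrM; congr (_ `^ _)%:E.
    by field; lra.
  have E3 : (\int[mu]_(x in D) (be x `^ p * cst 1 x)%:E =
             \int[mu]_(x in D) (be x `^ p)%:E)%E.
    by apply: eq_integral => x _; rewrite mulr1.
  rewrite E1 E2 E3; apply => //.
  - by rewrite divr_gt0//; lra.
  - by field; lra.
  - by rewrite powR_gt0.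
  - exact: measurable_fun_powR.
  - by move=> x _; exact: powR_ge0.
  - rewrite -powRrM (_ : (p - 1) * (p / (p - 1)) = p)//; by field; lra.
have Iap : mu.-integrable D (fun x => (al x `^ p)%:E).
  apply/integrableP; split; first exact/measurable_EFinP.
  rewrite (_ : (\int[mu]_(x in D) `|(al x `^ p)%:E| = \int[mu]_(x in D) (al x `^ p)%:E)%E).
    exact: le_lt_trans ial (ltry _).
  by apply: eq_integral => x _; rewrite gee0_abs// lee_fin powR_ge0.
have Iab : mu.-integrable D (fun x => (al x `^ (p - 1) * be x)%:E).
  apply/integrableP; split; first exact/measurable_EFinP.
  rewrite (_ : (\int[mu]_(x in D) `|(al x `^ (p - 1) * be x)%:E| =
    \int[mu]_(x in D) (al x `^ (p - 1) * be x)%:E)%E).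
    exact: le_lt_trans iab (ltry _).
  apply: eq_integral => x; rewrite inE => Dx.
  by rewrite gee0_abs// lee_fin mulr_ge0 ?powR_ge0 ?be0.
(* Exponents add only for a nonzero base; where [al] vanishes all four expressions are 0, even if
   [p - 2] is negative or zero. *)
have pw x : D x -> al x `^ (p - 2) * (al x ^+ 2) = al x `^ p /\
    al x `^ (p - 2) * (al x * be x) = al x `^ (p - 1) * be x.
  move=> Dx; have [->|a0] := eqVneq (al x) 0.
    by rewrite expr0n !mul0r mulr0 !powR0 ?gt_eqF ?mul0r//; lra.
  have a0' r : (r == 0) ==> (al x != 0) by rewrite a0 implybT.
  split.
    by rewrite -powR_mulrn ?al0// -powRD ?a0'// subrK.
  rewrite mulrA -[X in _ * X * be x](powRr1 (al0 x Dx)) -powRD ?a0'//.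
  by rewrite (_ : p - 2 + 1 = p - 1)//; ring.
have IL : mu.-integrable D (fun x => (al x `^ (p - 2) * (c x * s x))%:E).
  apply: le_integrable (integrableD mD Iap Iab) => //; first exact/measurable_EFinP.
  move=> x Dx /=; rewrite lee_fin.
  have /andP[c0 c1] := c01 x Dx; have [<- <-] := pw x Dx.
  rewrite -mulrDr !normrM (ger0_norm (powR_ge0 _ _)) ler_wpM2l ?powR_ge0//.
  rewrite [leRHS]ger0_norm; last by rewrite addr_ge0 ?sqr_ge0 ?mulr_ge0 ?al0 ?be0.
  by rewrite (ger0_norm c0) (le_trans (ler_piMl _ c1))// sle.
split=> //.
apply: (@le_trans _ _ (\int[mu]_(x in D) ((al x `^ (p - 2) * (c x * s x))%:E +
    (al x `^ (p - 1) * be x)%:E))%E); last first.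
  by rewrite integralD// leeD2l.
apply: le_integral => //.
- apply: le_integrable Iap => //; first exact/measurable_EFinP.
  move=> x Dx /=; rewrite lee_fin normrM ler_piMl//.
  by have /andP[c0 c1] := c01 x Dx; rewrite ger0_norm.
- exact: integrableD.
move=> x; rewrite inE => Dx; rewrite -EFinD lee_fin.
have /andP[c0 c1] := c01 x Dx; have [<- <-] := pw x Dx.
rewrite mulrCA -mulrDr ler_wpM2l ?powR_ge0//.
have := ler_wpM2l c0 (sge x Dx); rewrite mulrBr => h.
have : c x * (al x * be x) <= al x * be x by rewrite ler_piMl// mulr_ge0 ?al0 ?be0.
by lra.
Qed.

End energy.

(** If [Y] exceeded [C2 * x], then [C2 >= 1] would give [x < Y], so [x]^ p[could be replaced by]x
    [^ (p - 1) * Y]; dividing by [Y] contradicts the choice of [C2]. *)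
Lemma absorb {R : realType} (p C1 : R) : 1 < p -> 0 <= C1 ->
  exists2 C2 : R, 1 <= C2 & forall x Y : R, 0 < x -> 0 < Y ->
    Y `^ p <= 2 `^ p * (C1 * x `^ (p - 1) * Y + x `^ p) -> Y <= C2 * x.
Proof.
move=> p1 C10; have p10 : 0 < p - 1 by lra.
have p0 : 0 < p by lra.
pose B := 2 `^ p * (C1 + 1) : R.
have two : 1 <= 2 `^ p :> R.
  by rewrite -[leLHS](powRr0 2); apply: ler_powR; lra.
have B1 : 1 <= B by rewrite /B; nra.
have B0 : 0 <= B by lra.
exists (B `^ (p - 1)^-1).
  by rewrite -[leLHS](powRr0 B); apply: ler_powR => //; rewrite invr_ge0 ltW.
move=> x Y x0 Y0 h; rewrite leNgt; apply/negP => Yx.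
have C20 : 1 <= B `^ (p - 1)^-1.
  by rewrite -[leLHS](powRr0 B); apply: ler_powR => //; rewrite invr_ge0 ltW.
have xY : x < Y by apply: le_lt_trans Yx; rewrite ler_peMl// ltW.
have xp : x `^ p = x `^ (p - 1) * x by rewrite mulrC mulr_powRB1 ?(ltW x0).
have Yp : Y `^ p = Y `^ (p - 1) * Y by rewrite mulrC mulr_powRB1 ?(ltW Y0).
have : Y `^ p <= B * x `^ (p - 1) * Y.
  apply: (le_trans h); rewrite xp /B -!mulrA ler_wpM2l ?powR_ge0//.
  rewrite mulrDl mul1r lerD2l ler_wpM2l ?powR_ge0// ltW//.
rewrite Yp ler_pM2r// leNgt => /negP; apply.
have -> : B * x `^ (p - 1) = (B `^ (p - 1)^-1 * x) `^ (p - 1).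
  by rewrite powRM ?powR_ge0 ?(ltW x0)// -powRrM mulVf ?gt_eqF// powRr1.
by rewrite gt0_ltr_powR// nnegrE ?mulr_ge0 ?powR_ge0 ?(ltW x0) ?(ltW Y0).
Qed.

Section truncated_energy.
Context {d} {T : measurableType d} {R : realType}.
Context (mu : {measure set T -> \bar R}).
Implicit Types (D E : set T).

Lemma powRD_le (p x y : R) : 0 <= p -> 0 <= x -> 0 <= y ->
  (x + y) `^ p <= 2 `^ p * (x `^ p + y `^ p).
Proof.
move=> p0; wlog xy : x y / x <= y => [h x0 y0|x0 y0].
  have [xy|/ltW yx] := leP x y; first exact: h.
  by rewrite addrC [X in _ * X]addrC; exact: h.
apply: (@le_trans _ _ ((2 * y) `^ p)).
  by rewrite ge0_ler_powR ?nnegrE ?addr_ge0 ?mulr_ge0//; lra.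
by rewrite powRM// ler_wpM2l ?powR_ge0// lerDr powR_ge0.
Qed.

(** The energy bounds [phi] and [tau] by the Sobolev and subunit estimates, these bound the source
    terms, and the source terms bound the energy; [absorb] closes the circle. The two estimates are
    assumed for every [Y] because the relevant one is only built in the proof. *)
Lemma truncated_energy D E (v f g phi tau al be bn s c : T -> R)
    (p N x cA cB S Ct W e C2 : R) :
  measurable D -> measurable E -> E `<=` D -> 1 < p -> 1 < N ->
  0 < cA -> 0 < cB -> 0 < S -> 0 < Ct -> 0 < W -> 0 < e -> 0 < x ->
  (forall Y, 0 < Y ->
    Y `^ p <= 2 `^ p * ((cA * S + cB * Ct) * x `^ (p - 1) * Y + x `^ p) -> Y <= C2 * x) ->
  measurable_fun D v -> measurable_fun D f -> measurable_fun D g ->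
  measurable_fun D phi -> measurable_fun D tau -> measurable_fun D al ->
  measurable_fun D be -> measurable_fun D bn -> measurable_fun D s ->
  measurable_fun D c ->
  (forall y, D y -> 0 <= v y) -> (forall y, D y -> 0 <= phi y) ->
  (forall y, D y -> 0 <= al y) -> (forall y, D y -> 0 <= be y) ->
  (forall y, D y -> 0 <= bn y <= al y + be y) ->
  (forall y, D y -> 0 <= c y <= 1) ->
  (forall y, D y -> al y ^+ 2 - al y * be y <= s y) ->
  (forall y, D y -> `|s y| <= al y ^+ 2 + al y * be y) ->
  (forall y, D y -> ~ E y -> phi y = 0 /\ tau y = 0) ->
  (\int[mu]_(y in D) (al y `^ p)%:E <= (W `^ p)%:E)%E ->
  (\int[mu]_(y in D) (be y `^ p)%:E <= (e `^ p)%:E)%E ->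
  W `^ (p - 1) * e <= x `^ p / 2 -> e `^ p <= x `^ p / 2 ->
  (\int[mu]_(y in D) (al y `^ (p - 2) * (c y * s y))%:E <=
   \int[mu]_(y in D) ((`|f y| `^ (p - 1) * phi y + `|g y| `^ (p - 1) * `|tau y|) * v y)%:E)%E ->
  (forall Y, 0 < Y -> (\int[mu]_(y in D) ((c y * bn y) `^ p)%:E <= (Y `^ p)%:E)%E ->
    (\int[mu]_(y in D) (`|tau y| `^ p * v y)%:E <= ((Ct * Y) `^ p)%:E)%E) ->
  (forall Y, 0 < Y -> (\int[mu]_(y in D) ((c y * bn y) `^ p)%:E <= (Y `^ p)%:E)%E ->
    (\int[mu]_(y in D) (phi y `^ N * v y)%:E <= ((S * Y) `^ N)%:E)%E) ->
  (\int[mu]_(y in E) ((`|f y| `^ (p - 1)) `^ (N / (N - 1)) * v y)%:E <=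
    ((cA * x `^ (p - 1)) `^ (N / (N - 1)))%:E)%E ->
  (\int[mu]_(y in E) ((`|g y| `^ (p - 1)) `^ (p / (p - 1)) * v y)%:E <=
    ((cB * x `^ (p - 1)) `^ (p / (p - 1)))%:E)%E ->
  (\int[mu]_(y in D) (phi y `^ N * v y)%:E <= ((S * (C2 * x)) `^ N)%:E)%E.
Proof.
move=> mD mE ED p1 N1 cA0 cB0 S0 Ct0 W0 e0 x0 C2P mv mf mg mphi mtau mal mbe mbn ms mc
  v0 phi0 al0 be0 bnP cP sge sle supp ial ibe We ep weak htau hphi iF iG.
have p0 : 0 < p by lra.
have xp0 : 0 < x `^ (p - 1) by rewrite powR_gt0.
have [_ low] := energy_lower mD p1 W0 e0 mal mbe ms mc al0 be0 cP sge sle ial ibe.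
have mcal : measurable_fun D (fun y => c y * al y `^ p).
  by apply: measurable_funM => //; exact: measurable_fun_powR.
have cal0 y : D y -> 0 <= c y * al y `^ p.
  by move=> Dy; rewrite mulr_ge0 ?powR_ge0//; have /andP[] := cP y Dy.
have [Z Z0 ZE] : exists2 Z : R, 0 <= Z &
    (\int[mu]_(y in D) (c y * al y `^ p)%:E = Z%:E)%E.
  have i0 : (0 <= \int[mu]_(y in D) (c y * al y `^ p)%:E)%E.
    by apply: integral_ge0 => y Dy; rewrite lee_fin cal0.
  have ile : (\int[mu]_(y in D) (c y * al y `^ p)%:E <= (1 * W `^ p)%:E)%E.
    apply: le_integral_scale ial => //; first exact: measurable_fun_powR.
    - by move=> y _; exact: powR_ge0.
    - by move=> y Dy; rewrite ler_wpM2r ?powR_ge0//; have /andP[] := cP y Dy.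
  have fin : (\int[mu]_(y in D) (c y * al y `^ p)%:E)%E \is a fin_num.
    by rewrite ge0_fin_numE// (le_lt_trans ile) ?ltry.
  by exists (fine (\int[mu]_(y in D) (c y * al y `^ p)%:E)%E);
    [exact: fine_ge0|rewrite fineK].
rewrite ZE in low.
have ep0 : 0 < e `^ p by rewrite powR_gt0.
pose Y := 2 * (Z + e `^ p) `^ p^-1.
have Y0 : 0 < Y by rewrite mulr_gt0// powR_gt0; lra.
have YE : Y `^ p = 2 `^ p * (Z + e `^ p).
  by rewrite powRM ?powR_ge0// -powRrM mulVf ?gt_eqF// powRr1//; lra.
have mcbn : measurable_fun D (fun y => (c y * bn y) `^ p).
  by apply: measurable_fun_powR; exact: measurable_funM.
have icbn : (\int[mu]_(y in D) ((c y * bn y) `^ p)%:E <= (Y `^ p)%:E)%E.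
  rewrite YE mulrDr; apply: (@le_integral_lin _ _ _ mu D mD _
    (fun y => c y * al y `^ p) (fun y => be y `^ p)) => //.
  - exact: measurable_fun_powR.
  - by move=> y _; exact: powR_ge0.
  - by move=> y _; exact: powR_ge0.
  - move=> y Dy; have /andP[c0 c1] := cP y Dy; have /andP[b0 bab] := bnP y Dy.
    rewrite -mulrDr; apply: (@le_trans _ _ ((c y * al y + c y * be y) `^ p)).
      rewrite ge0_ler_powR ?nnegrE ?addr_ge0 ?mulr_ge0 ?al0 ?be0 ?(ltW p0)//.
      by rewrite -mulrDr ler_wpM2l.
    apply: le_trans (powRD_le (ltW p0) _ _) _; rewrite ?mulr_ge0 ?al0 ?be0//.
    rewrite ler_wpM2l ?powR_ge0// !powRM ?al0 ?be0//.
    have cp : c y `^ p <= c y.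
      have [->|cy0] := eqVneq (c y) 0; first by rewrite powR0 ?gt_eqF.
      by apply: ge1r_powR; [rewrite lt_def cy0 c0 c1|exact: ltW].
    apply: lerD; first by rewrite ler_wpM2r ?powR_ge0.
    by rewrite ler_piMl ?powR_ge0// (le_trans cp).
  - by rewrite ZE.
have itau := htau Y Y0 icbn; have iphi := hphi Y Y0 icbn.
have mfp : measurable_fun D (fun y => `|f y| `^ (p - 1)).
  by apply: measurable_fun_powR; exact: measurableT_comp.
have mgp : measurable_fun D (fun y => `|g y| `^ (p - 1)).
  by apply: measurable_fun_powR; exact: measurableT_comp.
have mtau' : measurable_fun D (fun y => `|tau y|) by exact: measurableT_comp.
have m1 : measurable_fun D (fun y => `|f y| `^ (p - 1) * phi y * v y).
  by apply: measurable_funM => //; exact: measurable_funM.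
have m2 : measurable_fun D (fun y => `|g y| `^ (p - 1) * `|tau y| * v y).
  by apply: measurable_funM => //; exact: measurable_funM.
have mN : measurable_fun D (fun y => phi y `^ N * v y).
  by apply: measurable_funM => //; exact: measurable_fun_powR.
have mT : measurable_fun D (fun y => `|tau y| `^ p * v y).
  by apply: measurable_funM => //; exact: measurable_fun_powR.
have i1 : (\int[mu]_(y in E) (`|f y| `^ (p - 1) * phi y * v y)%:E <=
    (cA * x `^ (p - 1) * (S * Y))%:E)%E.
  apply: (@hoelder_bound _ _ _ mu E mE _ _ _ (N / (N - 1)) N) iF _.
  - by rewrite divr_gt0//; lra.
  - by lra.
  - by field; lra.
  - by rewrite mulr_gt0.
  - by rewrite mulr_gt0.
  - exact: measurable_funS mfp.
  - exact: measurable_funS mphi.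
  - exact: measurable_funS mv.
  - by move=> y _; exact: powR_ge0.
  - by move=> y /ED; exact: phi0.
  - by move=> y /ED; exact: v0.
  - apply: le_trans iphi; apply: ge0_le_EFin_integral => // y Dy.
    by rewrite mulr_ge0 ?powR_ge0 ?v0.
have i2 : (\int[mu]_(y in E) (`|g y| `^ (p - 1) * `|tau y| * v y)%:E <=
    (cB * x `^ (p - 1) * (Ct * Y))%:E)%E.
  apply: (@hoelder_bound _ _ _ mu E mE _ _ _ (p / (p - 1)) p) iG _ => //.
  - by rewrite divr_gt0//; lra.
  - by field; lra.
  - by rewrite mulr_gt0.
  - by rewrite mulr_gt0.
  - exact: measurable_funS mgp.
  - exact: measurable_funS mtau'.
  - exact: measurable_funS mv.
  - by move=> y /ED; exact: v0.
  - apply: le_trans itau; apply: ge0_le_EFin_integral => // y Dy.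
    by rewrite mulr_ge0 ?powR_ge0 ?v0.
have i3 : (\int[mu]_(y in D) ((`|f y| `^ (p - 1) * phi y +
      `|g y| `^ (p - 1) * `|tau y|) * v y)%:E <=
    (1 * (cA * x `^ (p - 1) * (S * Y)) + 1 * (cB * x `^ (p - 1) * (Ct * Y)))%:E)%E.
  rewrite (integral_supported mu ED); last first.
    move=> y Dy nEy; have [-> ->] := supp y Dy nEy.
    by rewrite normr0 !mulr0 addr0 mul0r.
  apply: le_integral_lin i1 i2 => //.
  - apply: (measurable_funS mD ED).
    apply: eq_measurable_fun (measurable_funD m1 m2) => y _ /=.
    by rewrite mulrDl.
  - exact: measurable_funS m1.
  - exact: measurable_funS m2.
  - move=> y /ED Dy; rewrite mulr_ge0 ?v0// addr_ge0// mulr_ge0 ?powR_ge0//.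
    exact: phi0.
  - by move=> y /ED Dy; rewrite !mulr_ge0 ?powR_ge0 ?phi0 ?v0.
  - by move=> y /ED Dy; rewrite !mulr_ge0 ?powR_ge0 ?v0.
  - by move=> y Ey; rewrite mulrDl !mul1r.
have Zle : Z <= (cA * S + cB * Ct) * x `^ (p - 1) * Y + x `^ p / 2.
  rewrite -lee_fin; apply: (le_trans low).
  apply: (le_trans (leeD2r _ (le_trans weak i3))).
  rewrite -EFinD lee_fin; apply: (@le_trans _ _ ((cA * S + cB * Ct) * x `^ (p - 1) * Y +
    W `^ (p - 1) * e)); last by rewrite lerD2l.
  by rewrite le_eqVlt; apply/orP; left; apply/eqP; ring.
have YC2 : Y <= C2 * x.
  by apply: C2P => //; rewrite YE ler_wpM2l ?powR_ge0//; lra.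
apply: (le_trans iphi); rewrite lee_fin ge0_ler_powR ?nnegrE//.
- by lra.
- by rewrite mulr_ge0// ltW.
- by rewrite mulr_ge0 ?(ltW S0)// (le_trans (ltW Y0)).
- by rewrite ler_wpM2l// ltW.
Qed.

(** The exponents [kap] and [a] are left free so that the conditions on f and on g can be stated
    with one common quantity [th]. *)
Lemma orlicz_tail_scaled (p s P Q M : R) : 1 < p -> 0 < s -> (p - 1) * s < P ->
  0 <= Q -> 0 < M ->
  exists2 c : R, 0 < c & forall E (w f : T -> R) (y lam th kap a : R),
    measurable E -> measurable_fun E w -> measurable_fun E f ->
    (forall x, E x -> 0 <= w x) -> 0 <= y -> 0 < lam ->
    kap * ((p - 1) * s) = 1 - (p - 1) * s / P -> a * ((p - 1) * s) = Q * ((p - 1) * s) / P ->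
    th = expR (- (y * kap) - a * ln (1 + y)) ->
    (\int[mu]_(x in E) (w x)%:E <= (M * expR (- y))%:E)%E ->
    (\int[mu]_(x in E) ((`|f x| / lam) `^ P * ln (expR 1 + `|f x| / lam) `^ Q * w x)%:E <= 1)%E ->
    (\int[mu]_(x in E) ((`|f x| `^ (p - 1)) `^ s * w x)%:E <=
      ((c * (lam * th) `^ (p - 1)) `^ s)%:E)%E.
Proof.
move=> p1 s0 rP Q0 M0; have r0 : 0 < (p - 1) * s by rewrite mulr_gt0// subr_gt0.
have [C C0 CP] := orlicz_tail mu r0 rP Q0 M0.
exists (C `^ s^-1); first by rewrite powR_gt0.
move=> E w f y lam th kap a mE mw mf w0 y0 lam0 kapE aE thE iw if_.
have mfl : measurable_fun E (fun x => `|f x| / lam).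
  by apply: measurable_funM; [exact: measurableT_comp|exact: measurable_cst].
have fl0 x : 0 <= `|f x| / lam by rewrite divr_ge0// ltW.
have := CP E w (fun x => `|f x| / lam) y mE mw mfl w0 (fun x _ => fl0 x) y0 iw if_.
have -> : C * expR (- (y * (1 - (p - 1) * s / P)) - Q * ((p - 1) * s) / P * ln (1 + y)) =
    (C `^ s^-1 * th `^ (p - 1)) `^ s.
  rewrite powRM ?powR_ge0// -!powRrM mulVf ?gt_eqF// powRr1 ?(ltW C0)//.
  rewrite thE powR_expR -kapE -aE; congr (_ * expR _); ring.
move=> ile.
have -> : (C `^ s^-1 * (lam * th) `^ (p - 1)) `^ s =
    lam `^ ((p - 1) * s) * (C `^ s^-1 * th `^ (p - 1)) `^ s.
  rewrite (@powRM _ lam) ?(ltW lam0)//; last by rewrite thE expR_ge0.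
  rewrite mulrCA (@powRM _ (lam `^ (p - 1))) ?mulr_ge0 ?powR_ge0//.
  by rewrite (powRrM lam).
apply: le_integral_scale ile => //.
- by apply: measurable_funM => //; do 2 apply: measurable_fun_powR; exact: measurableT_comp.
- by apply: measurable_funM => //; exact: measurable_fun_powR.
- by move=> x Ex; rewrite mulr_ge0 ?powR_ge0 ?w0.
- by move=> x Ex; rewrite mulr_ge0 ?powR_ge0 ?w0.
- exact: powR_ge0.
move=> x Ex; rewrite mulrA -powRM ?(ltW lam0)// -powRrM.
by rewrite (mulrC lam) divfK ?gt_eqF.
Qed.

End truncated_energy.

(** * One step of the level iteration *)

Section level_decay.
Context {d} {T : measurableType d} {R : realType}.
Context (mu : {measure set T -> \bar R}).
Implicit Types (D E : set T).

(* Here psi approximates u, and in the application al = |sqrt(Q) U|,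
   be = |sqrt(Q) (grad psi - U)|, bn = |sqrt(Q) grad psi|, s = grad psi . Q U
   and tau = t . grad phi. *)
Definition truncation_test (p N S Ct k dl e : R) D (v f g u al : T -> R) :=
  exists psi be bn s tau : T -> R,
  let phi y := trunc k dl (psi y) in let c y := dtrunc k dl (psi y) in
  [/\ [/\ measurable_fun D psi, measurable_fun D be, measurable_fun D bn,
        measurable_fun D s & measurable_fun D tau],
    forall y, D y -> [/\ 0 <= be y, 0 <= bn y <= al y + be y,
        al y ^+ 2 - al y * be y <= s y, `|s y| <= al y ^+ 2 + al y * be y &
        psi y <= k -> tau y = 0],
    (\int[mu]_(y in D) (`|psi y - u y| `^ p * v y)%:E <= (e `^ p)%:E)%E /\
    (\int[mu]_(y in D) (be y `^ p)%:E <= (e `^ p)%:E)%E,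
    (\int[mu]_(y in D) (al y `^ (p - 2) * (c y * s y))%:E <=
     \int[mu]_(y in D)
       ((`|f y| `^ (p - 1) * phi y + `|g y| `^ (p - 1) * `|tau y|) * v y)%:E)%E &
    forall Y, 0 < Y -> (\int[mu]_(y in D) ((c y * bn y) `^ p)%:E <= (Y `^ p)%:E)%E ->
      (\int[mu]_(y in D) (`|tau y| `^ p * v y)%:E <= ((Ct * Y) `^ p)%:E)%E /\
      (\int[mu]_(y in D) (phi y `^ N * v y)%:E <= ((S * Y) `^ N)%:E)%E].

Lemma measurable_superlevel D (h : T -> R) (k : R) : measurable D ->
  measurable_fun D h -> measurable (D `&` [set y | k < h y]).
Proof.
move=> mD mh; have := mh mD _ (measurable_itv `]k, +oo[).
by congr measurable; apply/seteqP; split => y /=; rewrite in_itv/= andbT.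
Qed.

Lemma measurable_log_bump D (h : T -> R) (lam P Q : R) : measurable D -> measurable_fun D h ->
  measurable_fun D (fun y => (`|h y| / lam) `^ P * ln (expR 1 + `|h y| / lam) `^ Q).
Proof.
move=> mD mh.
have mhl : measurable_fun D (fun y => `|h y| / lam).
  by apply: measurable_funM; [exact: measurableT_comp|exact: measurable_cst].
apply: measurable_funM; apply: measurable_fun_powR => //.
apply: (measurableT_comp (@measurable_ln R)).
by apply: measurable_funD => //; exact: measurable_cst.
Qed.

End level_decay.

(** The level rises by three widths [dl]: one to pass from [u] to [psi], one for [trunc] to reach
    [dl / 2], one to return from [psi] to [u]. *)
Lemma level_decay d (T : measurableType d) (R : realType) (mu : {measure set T -> \bar R})
    (p sigma q S Ct M : R) : 1 < p -> 1 < sigma ->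
  conjugate sigma * (p - 1) < q -> 0 < S -> 0 < Ct -> 0 < M ->
  exists2 K : R, 0 < K & forall (D : set T) (v f g u al : T -> R) (lam : R),
    measurable D -> measurable_fun D v -> measurable_fun D f -> measurable_fun D g ->
    measurable_fun D u -> measurable_fun D al -> (forall y, D y -> 0 <= v y) ->
    (forall y, D y -> 0 <= al y) ->
    0 < lam ->
    (\int[mu]_(y in D) (Afun sigma p q (`|f y| / lam) * v y)%:E <= 1)%E ->
    (\int[mu]_(y in D) (Bfun sigma p q (`|g y| / lam) * v y)%:E <= 1)%E ->
    (exists2 W : R, 0 < W & (\int[mu]_(y in D) (al y `^ p)%:E <= (W `^ p)%:E)%E) ->
    (forall k dl e, 0 <= k -> 0 < dl -> 0 < e ->
      truncation_test mu p (sigma * p) S Ct k dl e D v f g u al) ->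
    forall (j : nat) (k : R), 0 <= k ->
    (\int[mu]_(y in D `&` [set y | (k < u y)%R]) (v y)%:E <= (M * expR (- j%:R))%:E)%E ->
    (\int[mu]_(y in D `&`
        [set y | (k + lam * K * (1 + j%:R) `^ (- (q / (conjugate sigma * (p - 1)))) < u y)%R])
       (v y)%:E <= (M * expR (- j.+1%:R))%:E)%E.
Proof.
move=> p1 sg1 qgt S0 Ct0 M0.
set N := sigma * p; set a := q / _.
have p0 : 0 < p by lra. have sg0 : 0 < sigma by lra.
have cs1 : 1 < conjugate sigma.
  by rewrite /conjugate ltr_pdivlMr; lra.
have cs0 : 0 < conjugate sigma by lra.
have p10 : 0 < p - 1 by lra. have sg10 : 0 < sigma - 1 by lra.
have csp0 : 0 < conjugate sigma * (p - 1) by rewrite mulr_gt0.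
have q0 : 0 < q by lra.
have N1 : 1 < N by rewrite /N; nra.
have N0 : 0 < N by lra. have N10 : 0 < N - 1 by lra.
have M20 : 0 < 2 * M by lra.
have s10 : 0 < N / (N - 1) by rewrite divr_gt0.
have s20 : 0 < p / (p - 1) by rewrite divr_gt0.
(* Conjugation reverses order and [N = sigma * p] exceeds [sigma]. *)
have r1 : (p - 1) * (N / (N - 1)) < conjugate sigma * (p - 1).
  rewrite mulrC ltr_pM2r// /conjugate ltr_pdivrMr// mulrAC ltr_pdivlMr//.
  by rewrite /N; nra.
have r2 : (p - 1) * (p / (p - 1)) < p * conjugate sigma.
  by rewrite mulrC divfK ?gt_eqF// ltr_pMr.
have q2 : 0 <= q * conjugate p by rewrite mulr_ge0 ?(ltW q0)// /conjugate ltW.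
have [cA cA0 cAP] := orlicz_tail_scaled mu p1 s10 r1 (ltW q0) M20.
have [cB cB0 cBP] := orlicz_tail_scaled mu p1 s20 r2 q2 M20.
have C10 : 0 <= cA * S + cB * Ct by rewrite addr_ge0 ?mulr_ge0 ?ltW.
have [C2 C21 C2P] := absorb p1 C10.
have C20 : 0 < C2 by lra.
(* Chosen so that the last Chebyshev estimate gives exactly [eta]. *)
pose G := (2 * expR 1 / M) `^ N^-1.
have G0 : 0 < G by rewrite powR_gt0// divr_gt0// mulr_gt0 ?expR_gt0.
exists (6 * S * C2 * G); first by rewrite !mulr_gt0.
move=> D v f g u al lam mD mv mf mg mu_ mal v0 al0 lam0 iA iB [W W0 iW] test j k k0 mk.
pose y := j%:R : R; have y0 : 0 <= y by rewrite /y.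
pose w := (1 + y) `^ (- a); have y1 : 0 < 1 + y by clear -y0; lra.
have w0 : 0 < w by rewrite powR_gt0.
pose th := expR (- (y * N^-1) - a * ln (1 + y)).
have th0 : 0 < th by rewrite expR_gt0.
have thE : th = expR (- (y * N^-1)) * w.
  by rewrite /th expRD /w /powR gt_eqF ?mulNr.
have [x xE] : exists x, x = lam * th by exists (lam * th).
have x0 : 0 < x by rewrite xE mulr_gt0.
have [dl dlE] : exists dl, dl = 2 * S * C2 * G * lam * w by eexists.
have dl0 : 0 < dl by rewrite dlE !mulr_gt0.
have kE : k + lam * (6 * S * C2 * G) * (1 + j%:R) `^ (- a) = k + dl + dl + dl.
  by rewrite -/y -/w dlE; ring.
rewrite kE.
(* Half of the target mass: the final set is covered by two sets of mass at most [eta]. *)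
have [eta etaE] : exists eta, eta = M * expR (- (y + 1)) / 2 by eexists.
have eta0 : 0 < eta by rewrite etaE divr_gt0// mulr_gt0// expR_gt0.
have etaM : eta <= M * expR (- y).
  rewrite etaE -mulrA ler_wpM2l ?(ltW M0)// ler_pdivrMr//.
  apply: (@le_trans _ _ (expR (- y))); first by rewrite ler_expR; clear -y; lra.
  by rewrite ler_peMr ?expR_ge0//; clear -R; lra.
have xp0 : 0 < x `^ p by rewrite powR_gt0.
have Wp0 : 0 < W `^ (p - 1) by rewrite powR_gt0.
pose e := Num.min (dl * eta `^ p^-1) (Num.min (x / 2) (x `^ p / 2 / W `^ (p - 1))).
have e0 : 0 < e.
  rewrite /e !lt_min; apply/and3P; split.
  - by rewrite mulr_gt0// powR_gt0.
  - by rewrite divr_gt0.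
  - by rewrite !divr_gt0.
have e1 : e `^ p <= eta * dl `^ p.
  apply: (@le_trans _ _ ((dl * eta `^ p^-1) `^ p)).
    rewrite ge0_ler_powR ?nnegrE ?(ltW p0) ?(ltW e0) ?mulr_ge0 ?powR_ge0 ?(ltW dl0)//.
    by rewrite /e ge_min lexx.
  rewrite powRM ?powR_ge0 ?(ltW dl0)// -powRrM mulVf ?gt_eqF// powRr1 ?(ltW eta0)//.
  by rewrite mulrC.
have e2 : e `^ p <= x `^ p / 2.
  apply: (@le_trans _ _ ((x * 2^-1) `^ p)).
    rewrite ge0_ler_powR ?nnegrE ?(ltW p0) ?(ltW e0) ?mulr_ge0 ?(ltW x0)//.
    by rewrite /e !ge_min lexx orbT.
  rewrite powRM ?(ltW x0)// ler_wpM2l ?(ltW xp0)//.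
  by apply: ge1r_powR; [clear -R; lra|exact: ltW].
have e3 : W `^ (p - 1) * e <= x `^ p / 2.
  by rewrite mulrC -ler_pdivlMr// /e !ge_min lexx !orbT.
have kd0 : 0 <= k + dl by rewrite addr_ge0 ?(ltW dl0).
have [psi [be [bn [s [tau [[mpsi mbe mbn ms mtau] pt [iu ibe] weak sub]]]]]] :=
  test (k + dl) dl e kd0 dl0 e0.
pose E := D `&` [set z | k + dl < psi z].
pose B := D `&` [set z | dl <= `|psi z - u z|].
have mpu : measurable_fun D (fun z => `|psi z - u z|).
  by apply: measurableT_comp => //; exact: measurable_funB.
have mE : measurable E by exact: measurable_superlevel.
have mB : measurable B.
  have := mpu mD _ (measurable_itv `[dl, +oo[).
  by congr measurable; apply/seteqP; split => z /=; rewrite in_itv/= andbT.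
have ED : E `<=` D by exact: subIsetl.
have BD : B `<=` D by exact: subIsetl.
have iBv : (\int[mu]_(z in B) (v z)%:E <= eta%:E)%E.
  apply: (@le_trans _ _ (e `^ p / dl `^ p)%:E).
    by apply: (@chebyshev_bound _ _ _ mu D B v (fun z => `|psi z - u z|) p dl) => // z [].
  by rewrite lee_fin ler_pdivrMr// powR_gt0.
have iE : (\int[mu]_(z in E) (v z)%:E <= (2 * M * expR (- y))%:E)%E.
  apply: (@le_trans _ _ (M * expR (- y) + eta)%:E); last by rewrite lee_fin; clear -etaM; lra.
  apply: (@integral_subsetU _ _ _ mu D E (D `&` [set z | k < u z]) B) => //.
  - exact: measurable_superlevel.
  - move=> z [Dz /= kz]; have [uz|uz] := ltP k (u z); [by left|right].
    by split=> //=; rewrite (le_trans _ (ler_norm _))//; clear -kz uz; lra.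
have v0E z : E z -> 0 <= v z by move=> /ED; exact: v0.
have iF : (\int[mu]_(z in E) ((`|f z| `^ (p - 1)) `^ (N / (N - 1)) * v z)%:E <=
    ((cA * x `^ (p - 1)) `^ (N / (N - 1)))%:E)%E.
  have fE : (\int[mu]_(z in E)
      ((`|f z| / lam) `^ (conjugate sigma * (p - 1)) * ln (expR 1 + `|f z| / lam) `^ q * v z)%:E
      <= 1)%E.
    apply: le_trans iA; apply: ge0_le_EFin_integral => // [|z Dz].
      by apply: measurable_funM => //; exact: measurable_log_bump.
    by rewrite mulr_ge0 ?v0// mulr_ge0 ?powR_ge0.
  have kapE : N^-1 * ((p - 1) * (N / (N - 1))) =
      1 - (p - 1) * (N / (N - 1)) / (conjugate sigma * (p - 1)).
    by rewrite /conjugate /N; field; rewrite !gt_eqF.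
  have aE : a * ((p - 1) * (N / (N - 1))) =
      q * ((p - 1) * (N / (N - 1))) / (conjugate sigma * (p - 1)).
    by rewrite /a; field; rewrite !gt_eqF.
  rewrite xE; exact: (cAP E v f y lam th N^-1 a mE (measurable_funS mD ED mv)
    (measurable_funS mD ED mf) v0E y0 lam0 kapE aE erefl iE fE).
have iG : (\int[mu]_(z in E) ((`|g z| `^ (p - 1)) `^ (p / (p - 1)) * v z)%:E <=
    ((cB * x `^ (p - 1)) `^ (p / (p - 1)))%:E)%E.
  have gE : (\int[mu]_(z in E)
      ((`|g z| / lam) `^ (p * conjugate sigma) *
        ln (expR 1 + `|g z| / lam) `^ (q * conjugate p) * v z)%:E <= 1)%E.
    apply: le_trans iB; apply: ge0_le_EFin_integral => // [|z Dz].
      by apply: measurable_funM => //; exact: measurable_log_bump.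
    by rewrite mulr_ge0 ?v0// mulr_ge0 ?powR_ge0.
  have kapE : N^-1 * ((p - 1) * (p / (p - 1))) =
      1 - (p - 1) * (p / (p - 1)) / (p * conjugate sigma).
    by rewrite /conjugate /N; field; rewrite !gt_eqF.
  (* The factor [conjugate p] in the logarithmic exponent of B makes this the same [a] as for f. *)
  have aE : a * ((p - 1) * (p / (p - 1))) =
      q * conjugate p * ((p - 1) * (p / (p - 1))) / (p * conjugate sigma).
    by rewrite /a [conjugate p]/conjugate; field; rewrite !gt_eqF.
  rewrite xE; exact: (cBP E v g y lam th N^-1 a mE (measurable_funS mD ED mv)
    (measurable_funS mD ED mg) v0E y0 lam0 kapE aE erefl iE gE).
pose phi z := trunc (k + dl) dl (psi z); pose c z := dtrunc (k + dl) dl (psi z).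
have mphi : measurable_fun D phi.
  exact: (measurableT_comp (continuous_measurable_fun (continuous_trunc (k := k + dl) dl0)) mpsi).
have mc : measurable_fun D c.
  exact: (measurableT_comp (continuous_measurable_fun (continuous_dtrunc (k := k + dl) dl0)) mpsi).
have phi0 z : D z -> 0 <= phi z by move=> _; exact: trunc_ge0.
have iphi : (\int[mu]_(z in D) (phi z `^ N * v z)%:E <= ((S * (C2 * x)) `^ N)%:E)%E.
  apply: (@truncated_energy _ _ _ mu D E v f g phi tau al be bn s c p N x cA cB S Ct W e C2) => //.
  - by move=> Y Y0; exact: C2P.
  - by move=> z Dz; have [] := pt z Dz.
  - by move=> z Dz; have [] := pt z Dz.
  - by move=> z _; exact: dtrunc_itv.
  - by move=> z Dz; have [] := pt z Dz.
  - by move=> z Dz; have [] := pt z Dz.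
  - move=> z Dz nEz; have kz : psi z <= k + dl.
      by rewrite leNgt; apply/negP => kz; apply: nEz; split.
    by split; [exact: trunc_le|have [_ _ _ _] := pt z Dz; apply].
  - by move=> Y Y0 /(sub Y Y0)[].
  - by move=> Y Y0 /(sub Y Y0)[].
have dl2 : 0 < dl / 2 by rewrite divr_gt0.
pose E2 := D `&` [set z | k + dl + dl < psi z].
have iE2 : (\int[mu]_(z in E2) (v z)%:E <= eta%:E)%E.
  apply: (@le_trans _ _ ((S * (C2 * x)) `^ N / (dl / 2) `^ N)%:E).
    apply: (@chebyshev_bound _ _ _ mu D E2 v phi N (dl / 2)) => //.
    - exact: measurable_superlevel.
    - exact: subIsetl.
    - by move=> z [Dz /= kz]; apply: trunc_ge => //; exact: ltW.
  rewrite lee_fin ler_pdivrMr ?powR_gt0//.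
  have -> : S * (C2 * x) = expR (- (y * N^-1)) / G * (dl / 2).
    by rewrite xE thE dlE; field; rewrite gt_eqF.
  rewrite powRM ?(ltW dl2) ?divr_ge0 ?expR_ge0 ?(ltW G0)//.
  rewrite ler_wpM2r ?powR_ge0//.
  have GN : G `^ N = 2 * expR 1 / M.
    by rewrite /G -powRrM mulVf ?gt_eqF// powRr1// divr_ge0 ?mulr_ge0 ?expR_ge0 ?(ltW M0).
  have GVN : G^-1 `^ N = M / (2 * expR 1).
    by rewrite -(powR_inv1 (ltW G0)) -powRrM mulN1r powRN GN invf_div.
  rewrite powRM ?expR_ge0 ?invr_ge0 ?(ltW G0)// GVN powR_expR etaE.
  rewrite (_ : N * - (y * N^-1) = - y); last by field; rewrite gt_eqF.
  rewrite opprD expRD (expRN 1).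
  rewrite le_eqVlt; apply/orP; left; apply/eqP.
  by field; rewrite gt_eqF ?expR_gt0.
apply: (@le_trans _ _ (eta + eta)%:E).
  apply: (@integral_subsetU _ _ _ mu D _ E2 B) => //.
  - exact: measurable_superlevel.
  - exact: measurable_superlevel.
  - move=> z [Dz /= kz]; have [uz|uz] := ltP (k + dl + dl) (psi z); [by left|right].
    by split=> //=; rewrite -normrN (le_trans _ (ler_norm _))//; clear -kz uz; lra.
  - exact: subIsetl.
rewrite lee_fin etaE -splitr -addn1 natrD.
by [].
Qed.

(** * Weak solutions *)

Section norms.
Context {R : realType}.

Lemma poweR_inv_le (X : \bar R) (p y : R) : (0 <= X)%E -> 0 < p -> 0 <= y ->
  (X `^ p^-1 <= y%:E)%E = (X <= (y `^ p)%:E)%E.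
Proof.
move=> X0 p0 y0; have ip0 : 0 < p^-1 by rewrite invr_gt0.
case: X X0 => [x| |]//; last by rewrite poweRyr ?gt_eqF// !leye_eq.
rewrite lee_fin => x0; rewrite poweR_EFin !lee_fin; apply/idP/idP => h.
  have := ge0_ler_powR (ltW p0) _ _ h; rewrite !nnegrE powR_ge0 y0.
  by rewrite -powRrM mulVf ?gt_eqF// powRr1//; apply.
have := ge0_ler_powR (ltW ip0) _ _ h; rewrite !nnegrE powR_ge0 x0.
by rewrite -powRrM mulfV ?gt_eqF// powRr1//; apply.
Qed.

Lemma poweR_inv_lty (X : \bar R) (p : R) : (0 <= X)%E -> 0 < p -> (X `^ p^-1 < +oo)%E ->
  exists2 W : R, 0 < W & (X <= (W `^ p)%:E)%E.
Proof.
move=> X0 p0 Xoo; have Xge := poweR_ge0 X p^-1.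
have Xfin : (X `^ p^-1)%E \is a fin_num by rewrite ge0_fin_numE.
have f0 : 0 <= fine (X `^ p^-1)%E by exact: fine_ge0.
exists (fine (X `^ p^-1)%E + 1); first by rewrite ltr_wpDl.
by rewrite -poweR_inv_le ?addr_ge0// EFinD fineK// leeDl// lee_fin.
Qed.

Lemma cvge0_near_le (x : (\bar R)^nat) (e : R) : 0 < e -> x @ \oo --> 0%E ->
  \forall j \near \oo, (x j <= e%:E)%E.
Proof.
move=> e0 x0.
have n0 : open_nbhs (0%E : \bar R) [set y | (y < e%:E)%E].
  by split; [exact: open_ereal_lt_ereal|rewrite /= lte_fin].
have : \forall j \near \oo, (x j < e%:E)%E := x0 _ (open_nbhs_nbhs n0).
by apply: filterS => j /ltW.
Qed.

End norms.

Lemma le_integral_EFin d (T : measurableType d) (R : realType)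
    (mu : {measure set T -> \bar R}) (D : set T) (h1 h2 : T -> R) :
  measurable D -> measurable_fun D h1 -> measurable_fun D h2 ->
  (forall x, D x -> 0 <= h1 x) -> (forall x, D x -> h1 x <= h2 x) ->
  (\int[mu]_(x in D) (h1 x)%:E <= \int[mu]_(x in D) (h2 x)%:E)%E.
Proof.
move=> mD mh1 mh2 h10 h12; apply: ge0_le_integral => //.
- exact/measurable_EFinP.
- exact/measurable_EFinP.
Qed.

Lemma measurable_scaled_powR d (T : measurableType d) (R : realType) (D : set T)
    (h v : T -> R) (l N : R) : measurable_fun D h -> measurable_fun D v ->
  measurable_fun D (fun x => (`|h x| / l) `^ N * v x).
Proof.
move=> mh mv; apply: measurable_funM => //; apply: measurable_fun_powR.
by apply: measurable_funM; [exact: measurableT_comp|exact: measurable_cst].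
Qed.

Section orlicz.
Context {R : realType} {n : nat}.
Local Notation Rn := 'rV[R]_n.+1.

Lemma orlicz_norm_ge0 (Phi : R -> R) (v h : Rn -> R) (Omega : set Rn) :
  (0 <= orlicz_norm Phi v Omega h)%E.
Proof.
by apply: le_ereal_inf_tmp => _ [l [/ltW l0 _] <-]; rewrite lee_fin.
Qed.

(** The strict inequality supplies an admissible [l' < l], so the infimum need not be attained. *)
Lemma orlicz_norm_lt (Phi : R -> R) (v h : Rn -> R) (Omega : set Rn) (l : R) :
  (forall x y, 0 <= x -> x <= y -> Phi x <= Phi y) -> 0 <= Phi 0 ->
  measurable Omega ->
  (forall l, measurable_fun Omega (fun x => Phi (`|h x| / l) * v x)) ->
  (forall x, Omega x -> 0 <= v x) ->
  (orlicz_norm Phi v Omega h < l%:E)%E ->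
  (\int[leb]_(x in Omega) (Phi (`|h x| / l) * v x)%:E <= 1)%E.
Proof.
move=> Phile Phi0 mO mPhi v0.
move=> /ereal_inf_lt[_ [l' [l'0 il'] <-]]; rewrite lte_fin => l'l.
have l0 : 0 < l by exact: lt_trans l'l.
have P0 x : 0 <= x -> 0 <= Phi x by move=> x0; apply: le_trans Phi0 (Phile _ _ _ x0).
apply: le_trans il'; 
apply: le_integral_EFin; [exact: mO|exact: mPhi|exact: mPhi| |].
- by move=> x Ox; rewrite mulr_ge0 ?v0// P0// divr_ge0// ltW.
- move=> x Ox; rewrite ler_wpM2r ?v0// Phile// ?divr_ge0 ?(ltW l0)//.
  by rewrite ler_wpM2l// lef_pV2 ?posrE// ltW.
Qed.

Lemma log_bump_le (P Q x y : R) : 0 <= P -> 0 <= Q -> 0 <= x -> x <= y ->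
  x `^ P * ln (expR 1 + x) `^ Q <= y `^ P * ln (expR 1 + y) `^ Q.
Proof.
move=> P0 Q0 x0 xy; have y0 := le_trans x0 xy.
have e1 : 1 <= expR 1 :> R by rewrite -expR0 ler_expR.
have ln0 z : 0 <= z -> 0 <= ln (expR 1 + z) :> R by move=> z0; apply: ln_ge0; lra.
apply: ler_pM; rewrite ?powR_ge0//; rewrite ge0_ler_powR ?nnegrE ?ln0//.
by rewrite ler_ln ?posrE ?lerD2l//; lra.
Qed.

End orlicz.

Section test_functions.
Context {R : realType} {n : nat}.
Local Notation Rn := 'rV[R]_n.+1.

Lemma weak_integrand_integrable d (T : measurableType d) (mu : {measure set T -> \bar R})
    (D : set T) (al bn s : T -> R) (p A B : R) : measurable D -> 1 < p ->
  measurable_fun D al -> measurable_fun D bn -> measurable_fun D s ->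
  (forall x, D x -> 0 <= al x) -> (forall x, D x -> 0 <= bn x) ->
  (forall x, D x -> `|s x| <= al x * bn x) ->
  (\int[mu]_(x in D) (al x `^ p)%:E <= A%:E)%E ->
  (\int[mu]_(x in D) (bn x `^ p)%:E <= B%:E)%E ->
  mu.-integrable D (fun x => (al x `^ (p - 2) * s x)%:E).
Proof.
move=> mD p1 mal mbn ms al0 bn0 sle iA iB.
have p0 : 0 < p by lra.
have ms' : measurable_fun D (fun x => al x `^ (p - 2) * s x).
  by apply: measurable_funM => //; exact: measurable_fun_powR.
have map : measurable_fun D (fun x => al x `^ p) by exact: measurable_fun_powR.
have mbp : measurable_fun D (fun x => bn x `^ p) by exact: measurable_fun_powR.
apply/integrableP; split; first exact/measurable_EFinP.
apply: (@le_lt_trans _ _ (1 * A + 1 * B)%:E); last exact: ltry.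
apply: (@le_integral_lin _ _ _ mu D mD (fun x => `|al x `^ (p - 2) * s x|)
  (fun x => al x `^ p) (fun x => bn x `^ p)) => //.
- exact: measurableT_comp.
- by move=> x _; exact: powR_ge0.
- by move=> x _; exact: powR_ge0.
move=> x Dx; rewrite !mul1r normrM (ger0_norm (powR_ge0 _ _)).
have [a0|a0] := eqVneq (al x) 0.
  have -> : s x = 0.
    by apply/eqP; rewrite -normr_le0 (le_trans (sle x Dx))// a0 mul0r.
  by rewrite normr0 mulr0 addr_ge0 ?powR_ge0.
have apos : 0 < al x by rewrite lt_def a0 al0.
apply: (@le_trans _ _ (al x `^ (p - 2) * (al x * bn x))).
  by rewrite ler_wpM2l ?powR_ge0// sle.
have -> : al x `^ (p - 2) * (al x * bn x) = al x `^ (p - 1) * bn x.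
  rewrite mulrA -[X in _ * X * _](powRr1 (ltW apos)) -powRD ?a0 ?implybT//.
  by rewrite (_ : p - 2 + 1 = p - 1)//; ring.
have [ab|ba] := leP (al x) (bn x).
  apply: (@le_trans _ _ (bn x `^ p)); last by rewrite lerDr powR_ge0.
  rewrite -(mulr_powRB1 (bn0 x Dx) p0) mulrC ler_wpM2l ?bn0//.
  by rewrite ge0_ler_powR ?nnegrE ?bn0 ?al0//; lra.
apply: (@le_trans _ _ (al x `^ p)); last by rewrite lerDl powR_ge0.
by rewrite -(mulr_powRB1 (al0 x Dx) p0) mulrC ler_wpM2r ?powR_ge0// ltW.
Qed.

(** The only place where the structure of the problem enters the abstract iteration: [psi] is a term
    of the approximating sequence within [e] of [(u, U)] in both norms. *)
Lemma Lip0_truncation_test (Omega : set Rn) (p N S_N Ct k dl e : R)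
    (v f g u : Rn -> R) (t U : Rn -> 'cV[R]_n.+1) (Q : Rn -> 'M[R]_n.+1) :
  open Omega -> 1 < p -> 0 < N -> weight Omega v -> measurable_field Omega t ->
  measurable_mx_field Omega Q ->
  (forall x, Omega x -> (Q x)^T = Q x /\ nonneg_def (Q x)) ->
  degenerate_subunit p v Q Omega t Ct ->
  sobolev_inequality (fun y => y `^ N) p v Q Omega S_N ->
  in_QH0 p v Q Omega u U ->
  (forall phi : Rn -> R, Lip0 Omega phi -> (forall x, 0 <= phi x) ->
    (QLp_norm p Q Omega (grad phi) < +oo)%E ->
    (weak_lhs p Q Omega U phi <= \int[leb]_(x in Omega)
      ((`|f x| `^ (p - 1) * phi x + `|g x| `^ (p - 1) * `|dot (t x) (grad phi x)|) * v x)%:E)%E) ->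
  0 <= k -> 0 < dl -> 0 < e ->
  truncation_test leb p N (`|S_N| + 1) Ct k dl e Omega v f g u
    (fun x => enorm (sqrtmx (Q x) *m U x)).
Proof.
move=> oO p1 N0 [mv v0] mt mQ Qsym [Ct0 sub] sob [[mu_ _] [mU nU] [psis [lpsis cu cU]]] weak k0 dl0 e0.
have p0 : 0 < p by lra.
have mO : measurable Omega by exact: rV_open_measurable.
have int0 (h : Rn -> R) : (forall x, Omega x -> 0 <= h x) ->
    (0 <= \int[leb]_(x in Omega) (h x)%:E)%E.
  by move=> h0; apply: integral_ge0 => x Ox; rewrite lee_fin h0.
have [j [ju jU]] : exists j, (Lp_norm p v Omega (psis j \- u)%R <= e%:E)%E /\
    (QLp_norm p Q Omega (grad (psis j) \- U)%R <= e%:E)%E.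
  have [j _ jP] := filterI (cvge0_near_le e0 cu) (cvge0_near_le e0 cU).
  by exists j; apply: (jP j) => /=.
set psi := psis j in ju jU; have lpsi : Lip0 Omega psi := lpsis j.
pose phi := trunc k dl \o psi.
have lphi : Lip0 Omega phi by exact: Lip0_trunc.
have gphi x : Omega x -> grad phi x = dtrunc k dl (psi x) *: grad psi x.
  by move=> Ox; exact: grad_trunc lpsi Ox.
pose A x := sqrtmx (Q x).
have mgpsi := measurable_grad mO lpsi; have mgphi := measurable_grad mO lphi.
have mbe : measurable_fun Omega (fun x => enorm (A x *m (grad psi x - U x))) :=
  measurable_enorm_sqrtmx mQ Qsym (measurable_fieldB mgpsi mU).
have mbn : measurable_fun Omega (fun x => enorm (A x *m grad psi x)) :=
  measurable_enorm_sqrtmx mQ Qsym mgpsi.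
have mbphi : measurable_fun Omega (fun x => enorm (A x *m grad phi x)) :=
  measurable_enorm_sqrtmx mQ Qsym mgphi.
have mal : measurable_fun Omega (fun x => enorm (A x *m U x)) :=
  measurable_enorm_sqrtmx mQ Qsym mU.
have ms : measurable_fun Omega (fun x => dot (grad psi x) (Q x *m U x)) :=
  measurable_dot mgpsi (measurable_mulmx mQ mU).
have mtau : measurable_fun Omega (fun x => dot (t x) (grad phi x)) :=
  measurable_dot mt mgphi.
have mpsi : measurable_fun Omega psi :=
  rV_continuous_measurable mO (Lip0_continuous lpsi).
have mphi : measurable_fun Omega phi :=
  rV_continuous_measurable mO (Lip0_continuous lphi).
have c01 x : 0 <= dtrunc k dl (psi x) <= 1 by exact: dtrunc_itv.
have bnorm x : Omega x -> enorm (A x *m grad phi x) =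
    dtrunc k dl (psi x) * enorm (A x *m grad psi x).
  move=> Ox; rewrite gphi// -scalemxAr enormZ//.
  by have /andP[] := c01 x.
have bdec x : A x *m grad psi x = A x *m U x + A x *m (grad psi x - U x).
  by rewrite -mulmxDr addrC subrK.
have ibe : (\int[leb]_(x in Omega) (enorm (A x *m (grad psi x - U x)) `^ p)%:E <= (e `^ p)%:E)%E.
  rewrite -poweR_inv_le ?(ltW e0)//.
  by apply: int0 => x _; exact: powR_ge0.
have ial0 : (0 <= \int[leb]_(x in Omega) (enorm (A x *m U x) `^ p)%:E)%E.
  by apply: int0 => x _; exact: powR_ge0.
have [W W0 iW] := poweR_inv_lty ial0 p0 nU.
have sE x : Omega x -> dot (grad psi x) (Q x *m U x) =
    enorm (A x *m U x) ^+ 2 + dot (A x *m (grad psi x - U x)) (A x *m U x).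
  move=> Ox; have [Qs Qn] := Qsym x Ox.
  by rewrite dot_sqrtmx// -/(A x) bdec dotDl sqr_enorm.
exists psi, (fun x => enorm (A x *m (grad psi x - U x))),
  (fun x => enorm (A x *m grad psi x)), (fun x => dot (grad psi x) (Q x *m U x)),
  (fun x => dot (t x) (grad phi x)); split.
- split; [exact: mpsi|exact: mbe|exact: mbn|exact: ms|exact: mtau].
- move=> x Ox; have ab := dot_le_enorm (A x *m (grad psi x - U x)) (A x *m U x).
  split.
  + exact: enorm_ge0.
  + by rewrite enorm_ge0/= bdec enormD.
  + by rewrite sE// lerD2l mulrC; move: ab; rewrite ler_norml => /andP[].
  + rewrite sE//; apply: le_trans (ler_normD _ _) _.
    by rewrite ger0_norm ?sqr_ge0// lerD2l mulrC.
  + by move=> xk; rewrite gphi// dtrunc_le// scale0r dotC dot0l.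
- split; last exact: ibe.
  rewrite -poweR_inv_le ?(ltW e0)//.
  by apply: int0 => x Ox; rewrite mulr_ge0 ?powR_ge0 ?v0.
(* The energy of the test function is finite because [psi] is close to [U], whose energy is
   finite. *)
- suff Qoo : (QLp_norm p Q Omega (grad phi) < +oo)%E.
    apply: le_trans (weak phi lphi (fun x => trunc_ge0 _ _ dl0) Qoo).
    rewrite le_eqVlt; apply/orP; left; apply/eqP; apply: eq_integral => x.
    by rewrite inE => Ox; rewrite gphi// dotZl.
  apply: poweR_lty; apply: le_lt_trans (ltry (2 `^ p * W `^ p + 2 `^ p * e `^ p)).
  apply: (le_integral_lin mO _ _ _ _ _ _ _ _ _ iW ibe).
  + exact: (measurable_fun_powR p mbphi).
  + exact: (measurable_fun_powR p mal).
  + exact: (measurable_fun_powR p mbe).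
  + by move=> x _; exact: powR_ge0.
  + by move=> x _; exact: powR_ge0.
  + by move=> x _; exact: powR_ge0.
  + exact: powR_ge0.
  + exact: powR_ge0.
  move=> x Ox; rewrite -mulrDr.
  apply: le_trans (powRD_le (ltW p0) (enorm_ge0 _) (enorm_ge0 _)).
  rewrite ge0_ler_powR ?nnegrE ?addr_ge0 ?enorm_ge0 ?(ltW p0)//.
  have /andP[c0 c1] := c01 x; rewrite -/(A x) bnorm//.
  apply: (@le_trans _ _ (enorm (A x *m grad psi x))).
    by rewrite ler_piMl// enorm_ge0.
  by rewrite bdec enormD.
move=> Y Y0 iY.
have QY : (QLp_norm p Q Omega (grad phi) <= Y%:E)%E.
  have i0 := int0 _ (fun x _ => powR_ge0 (enorm (A x *m grad phi x)) p).
  rewrite /QLp_norm (poweR_inv_le i0 p0 (ltW Y0)).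
  apply: le_trans iY; rewrite le_eqVlt; apply/orP; left; apply/eqP.
  by apply: eq_integral => x; rewrite inE => Ox; rewrite -/(A x) bnorm.
split.
  have i0 : (0 <= \int[leb]_(x in Omega)
      (`|dot (t x) (grad phi x)| `^ p * v x)%:E)%E.
    by apply: int0 => x Ox; rewrite mulr_ge0 ?powR_ge0 ?v0.
  rewrite -(poweR_inv_le i0 p0 (ltW (mulr_gt0 Ct0 Y0))).
  apply: le_trans (sub phi lphi) _; rewrite EFinM lee_wpmul2l//.
  by rewrite lee_fin ltW.
(* The added 1 gives the strict inequality required by [orlicz_norm_lt]; the absolute value covers
   either sign of [S_N]. *)
have SY0 : 0 < (`|S_N| + 1) * Y by rewrite mulr_gt0// ltr_wpDl.
have SYlt : (orlicz_norm (fun y => (y `^ N)%R) v Omega phi < ((`|S_N| + 1) * Y)%:E)%E.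
  apply: le_lt_trans (sob phi lphi) _.
  apply: (@le_lt_trans _ _ (`|S_N|%:E * Y%:E)%E).
    apply: (@le_trans _ _ (`|S_N|%:E * QLp_norm p Q Omega (grad phi))%E).
      by rewrite lee_wpmul2r ?poweR_ge0// lee_fin ler_norm.
    by rewrite lee_wpmul2l// lee_fin.
  by rewrite -EFinM lte_fin ltr_pM2r// ltrDl.
have mphil l : measurable_fun Omega (fun x => (`|phi x| / l) `^ N * v x) :=
  measurable_scaled_powR l N mphi mv.
have iphi := orlicz_norm_lt (fun x y x0 xy => ge0_ler_powR (ltW N0) x0
  (le_trans x0 xy) xy) (powR_ge0 _ _) mO mphil v0 SYlt.
rewrite -[X in (_ <= X%:E)%E]mulr1.
apply: (le_integral_scale mO _ (mphil ((`|S_N| + 1) * Y)) _ _ _ _ iphi).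
- exact: (measurable_funM (measurable_fun_powR N mphi) mv).
- by move=> x Ox; rewrite mulr_ge0 ?powR_ge0 ?v0.
- by move=> x Ox; rewrite mulr_ge0 ?powR_ge0 ?v0.
- exact: powR_ge0.
move=> x Ox; rewrite mulrA -powRM ?divr_ge0 ?(ltW SY0)//.
rewrite (mulrC _ (`|phi x| / _)) divfK ?gt_eqF// ger0_norm//.
exact: trunc_ge0.
Qed.

End test_functions.

(** * Passage from subsolutions to supersolutions *)

Section weak_forms.
Context {d} {T : measurableType d} {R : realType}.
Context (mu : {measure set T -> \bar R}).

Lemma integral_EFinN (D : set T) (h : T -> R) : measurable D ->
  mu.-integrable D (EFin \o h) ->
  (\int[mu]_(x in D) (- h x)%:E = - \int[mu]_(x in D) (h x)%:E)%E.
Proof.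
move=> mD ih; have := integralZl mD ih (-1).
rewrite mulN1e => <-; apply: eq_integral => x _ /=.
by rewrite -EFinM mulN1r.
Qed.

(** The majorant is blind to the signs of the data, so it serves subsolutions and negated
    supersolutions alike. *)
Lemma abs_source_integral (D : set T) (f g phi tau v : T -> R) (p : R) :
  measurable D -> 1 < p -> measurable_fun D f -> measurable_fun D g ->
  measurable_fun D phi -> measurable_fun D tau -> measurable_fun D v ->
  (forall x, D x -> 0 <= phi x) -> (forall x, D x -> 0 <= v x) ->
  (`| \int[mu]_(x in D) ((f x * `|f x| `^ (p - 2) * phi x +
       `|g x| `^ (p - 2) * g x * tau x) * v x)%:E | <=
   \int[mu]_(x in D) ((`|f x| `^ (p - 1) * phi x + `|g x| `^ (p - 1) * `|tau x|) * v x)%:E)%E.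
Proof.
move=> mD p1 mf mg mphi mtau mv phi0 v0.
have mnp (h : T -> R) (r : R) : measurable_fun D h -> measurable_fun D (fun x => `|h x| `^ r).
  by move=> mh; apply: measurable_fun_powR; exact: measurableT_comp.
have m1 : measurable_fun D (fun x => (f x * `|f x| `^ (p - 2) * phi x +
    `|g x| `^ (p - 2) * g x * tau x) * v x).
  apply: measurable_funM => //; apply: measurable_funD.
    by apply: measurable_funM => //; apply: measurable_funM => //; exact: mnp.
  by apply: measurable_funM => //; apply: measurable_funM => //; exact: mnp.
have m2 : measurable_fun D (fun x => (`|f x| `^ (p - 1) * phi x +
    `|g x| `^ (p - 1) * `|tau x|) * v x).
  apply: measurable_funM => //; apply: measurable_funD.
    by apply: measurable_funM => //; exact: mnp.
  by apply: measurable_funM; [exact: mnp|exact: measurableT_comp].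
have E1 : measurable_fun D (fun x => ((f x * `|f x| `^ (p - 2) * phi x +
    `|g x| `^ (p - 2) * g x * tau x) * v x)%:E) by exact/measurable_EFinP.
apply: le_trans (le_abse_integral mu mD E1) _ => /=.
apply: le_integral_EFin mD _ m2 _ _; first exact: measurableT_comp.
  by move=> x _.
move=> x Dx; rewrite normrM (ger0_norm (v0 x Dx)) ler_wpM2r ?v0//.
have pw (z : R) : `|z| * `|z| `^ (p - 2) = `|z| `^ (p - 1).
  rewrite (_ : p - 2 = p - 1 - 1); last by ring.
  by rewrite mulr_powRB1//; lra.
apply: le_trans (ler_normD _ _) _; rewrite !normrM !(ger0_norm (powR_ge0 _ _)).
by rewrite pw (mulrC (_ `^ _) `|g x|) pw (ger0_norm (phi0 x Dx)).
Qed.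

End weak_forms.

Section negation.
Context {R : realType} {n : nat}.
Local Notation Rn := 'rV[R]_n.+1.
Implicit Types (psi phi u v : Rn -> R) (Omega : set Rn).

Lemma Lip0N Omega psi : Lip0 Omega psi -> Lip0 Omega (\- psi).
Proof.
move=> [lip cpt sup].
have E : [set x | (\- psi) x != 0] = [set x | psi x != 0].
  by apply/seteqP; split => x /=; rewrite oppr_eq0.
split; rewrite ?E// => x Ox.
have [M [Mr ML]] := lip x Ox; exists M; split => // M' /ML ML'.
have ML2 : nbhs (x, x) [set y : Rn * Rn | `|psi y.1 - psi y.2| <= M' * `|y.1 - y.2|] := ML'.
apply: filterS ML2 => y /= yM.
by rewrite -opprD normrN.
Qed.

Lemma gradN psi x : grad (\- psi) x = - grad psi x.
Proof.
apply/matrixP => i j; rewrite !mxE -mulN1r; apply: lim_approx_scale.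
rewrite (_ : (fun h : R => _) = fun=> 0); first exact: cvg_cst.
by apply/funext => h; rewrite /= /GRing.scale/=; ring.
Qed.

Lemma in_QH0N p v Q Omega u (U : Rn -> 'cV[R]_n.+1) :
  in_QH0 p v Q Omega u U -> in_QH0 p v Q Omega (\- u) (fun x => - U x).
Proof.
move=> [[mu_ nu] [mU nU] [psi [lpsi cu cU]]].
have uE (a b : Rn -> R) : (forall x, `|a x| = `|b x|) ->
    Lp_norm p v Omega a = Lp_norm p v Omega b.
  move=> ab; rewrite /Lp_norm.
  suff E : (fun x => (`|a x| `^ p * v x)%:E) = (fun x => (`|b x| `^ p * v x)%:E).
    by rewrite E.
  by apply/funext => x; rewrite ab.
have UE (a b : Rn -> 'cV[R]_n.+1) : (forall x, a x = - b x) ->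
    QLp_norm p Q Omega a = QLp_norm p Q Omega b.
  move=> ab; rewrite /QLp_norm.
  suff E : (fun x => (enorm (sqrtmx (Q x) *m a x) `^ p)%:E) =
      (fun x => (enorm (sqrtmx (Q x) *m b x) `^ p)%:E) by rewrite E.
  by apply/funext => x; rewrite ab mulmxN enormN.
split.
- split; first exact: measurable_funN.
  by rewrite (uE _ u)// => x; rewrite normrN.
- split; last by rewrite (UE _ U).
  move=> i; apply: eq_measurable_fun (measurable_funN (mU i)) => x _ /=.
  by rewrite [in RHS]mxE.
exists (fun j => \- psi j); split.
- by move=> j; exact: Lip0N.
- apply: cvg_trans cu; apply: near_eq_cvg; near=> j.
  by apply: uE => x /=; rewrite -opprD normrN.
- apply: cvg_trans cU; apply: near_eq_cvg; near=> j.
  by apply: UE => x; rewrite /= gradN opprK opprD opprK.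
Unshelve. all: by end_near. Qed.

End negation.

Section boundedness.
Context {R : realType} {n : nat}.
Local Notation Rn := 'rV[R]_n.+1.

(** [C] is fixed before [Q], the data and the solution. The weak inequality is asked only for test
    functions of finite energy, which is what the negation of a supersolution can provide. *)
Lemma sublevel_null (Omega : set Rn) (p sigma q S_N Ct : R) (v : Rn -> R)
    (t : Rn -> 'cV[R]_n.+1) :
  open Omega -> 1 < p -> weight Omega v -> leb.-integrable Omega (EFin \o v) ->
  measurable_field Omega t -> 1 < sigma -> conjugate sigma * (p - 1) < q -> 0 < Ct ->
  exists2 C : R, 0 < C & forall (Q : Rn -> 'M[R]_n.+1) (f g u : Rn -> R)
      (U : Rn -> 'cV[R]_n.+1) (lam : R),
    measurable_mx_field Omega Q ->
    (forall x, Omega x -> (Q x)^T = Q x /\ nonneg_def (Q x)) ->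
    degenerate_subunit p v Q Omega t Ct ->
    sobolev_inequality (Nfun sigma p) p v Q Omega S_N ->
    measurable_fun Omega f -> measurable_fun Omega g ->
    (orlicz_norm (Afun sigma p q) v Omega f < lam%:E)%E ->
    (orlicz_norm (Bfun sigma p q) v Omega g < lam%:E)%E ->
    in_QH0 p v Q Omega u U ->
    (forall phi : Rn -> R, Lip0 Omega phi -> (forall x, 0 <= phi x) ->
      (QLp_norm p Q Omega (grad phi) < +oo)%E ->
      (weak_lhs p Q Omega U phi <= \int[leb]_(x in Omega)
        ((`|f x| `^ (p - 1) * phi x + `|g x| `^ (p - 1) * `|dot (t x) (grad phi x)|) * v x)%:E)%E) ->
    weight_of v (Omega `&` [set x | C * lam < u x]) = 0%E.
Proof.
move=> oO p1 wv vL1 mt sg1 qgt Ct0.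
have p0 : 0 < p by lra.
have cs0 : 0 < conjugate sigma by rewrite /conjugate divr_gt0; lra.
have csp0 : 0 < conjugate sigma * (p - 1) by rewrite mulr_gt0 ?subr_gt0.
have q0 : 0 < q by exact: lt_trans qgt.
have N0 : 0 < sigma * p by rewrite mulr_gt0//; lra.
have [mv v0] := wv.
have mO : measurable Omega := rV_open_measurable oO.
have Vfin : (\int[leb]_(x in Omega) (v x)%:E)%E \is a fin_num.
  exact: integrable_fin_num mO _ vL1.
have V0 : (0 <= \int[leb]_(x in Omega) (v x)%:E)%E.
  by apply: integral_ge0 => x Ox; rewrite lee_fin v0.
(* The added 1 keeps [M] positive when the total mass is 0. *)
pose M := fine (\int[leb]_(x in Omega) (v x)%:E)%E + 1.
have M0 : 0 < M by rewrite ltr_wpDl// fine_ge0.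
have S0 : 0 < `|S_N| + 1 by rewrite ltr_wpDl.
have [K K0 decay] :=
  @level_decay _ Rn R leb p sigma q (`|S_N| + 1) Ct M p1 sg1 qgt S0 Ct0 M0.
set a := q / (conjugate sigma * (p - 1)) in decay.
have a1 : 1 < a by rewrite ltr_pdivlMr// mul1r.
exists (K * 2 `^ a / (a - 1)); first by rewrite divr_gt0 ?subr_gt0// mulr_gt0// powR_gt0.
move=> Q f g u U lam mQ Qsym sub sob mf mg flam glam uQH weak.
have lam0 : 0 < lam by rewrite -lte_fin; exact: le_lt_trans (orlicz_norm_ge0 _ _ _ _) flam.
have cq0 : 0 <= q * conjugate p.
  by rewrite mulr_ge0 ?(ltW q0)// /conjugate divr_ge0// ?(ltW p0)// subr_ge0 ltW.
have pc0 : 0 <= p * conjugate sigma by rewrite mulr_ge0 ?(ltW p0) ?(ltW cs0).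
have iA : (\int[leb]_(x in Omega) (Afun sigma p q (`|f x| / lam) * v x)%:E <= 1)%E.
  apply: (orlicz_norm_lt _ _ mO _ v0 flam).
  - by move=> x y x0 xy; apply: log_bump_le => //; exact: ltW.
  - by rewrite mulr_ge0 ?powR_ge0.
  - by move=> l; exact: (measurable_funM (measurable_log_bump l _ _ mO mf) mv).
have iB : (\int[leb]_(x in Omega) (Bfun sigma p q (`|g x| / lam) * v x)%:E <= 1)%E.
  apply: (orlicz_norm_lt _ _ mO _ v0 glam).
  - by move=> x y x0 xy; exact: log_bump_le.
  - by rewrite mulr_ge0 ?powR_ge0.
  - by move=> l; exact: (measurable_funM (measurable_log_bump l _ _ mO mg) mv).
have [[mu_ _] [mU nU] _] := uQH.
have mal : measurable_fun Omega (fun x => enorm (sqrtmx (Q x) *m U x)) :=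
  measurable_enorm_sqrtmx mQ Qsym mU.
have ial0 : (0 <= \int[leb]_(x in Omega) (enorm (sqrtmx (Q x) *m U x) `^ p)%:E)%E.
  by apply: integral_ge0 => x _; rewrite lee_fin powR_ge0.
have iW := poweR_inv_lty ial0 p0 nU.
have test k dl e : 0 <= k -> 0 < dl -> 0 < e ->
    truncation_test leb p (sigma * p) (`|S_N| + 1) Ct k dl e Omega v f g u
      (fun x => enorm (sqrtmx (Q x) *m U x)).
  exact: (Lip0_truncation_test oO p1 N0 wv mt mQ Qsym sub sob uQH weak).
have step := decay Omega v f g u _ lam mO mv mf mg mu_ mal v0
  (fun x _ => enorm_ge0 _) lam0 iA iB iW test.
pose m (k : R) : \bar R := weight_of v (Omega `&` [set x | k < u x]).
have mlev k : measurable (Omega `&` [set x | k < u x]) := measurable_superlevel k mO mu_.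
have m_ge0 k : (0 <= m k)%E.
  by apply: integral_ge0 => x [Ox _]; rewrite lee_fin v0.
have mle x y : x <= y -> (m y <= m x)%E.
  move=> xy; apply: ge0_le_EFin_integral.
  - exact: mlev.
  - exact: mlev.
  - by move=> z [Oz /= yz]; split => //=; exact: le_lt_trans yz.
  - exact: (measurable_funS mO (@subIsetl _ _ _) mv).
  - by move=> z [Oz _]; exact: v0.
have m0 : (m 0%R <= M%:E)%E.
  apply: (@le_trans _ _ (\int[leb]_(x in Omega) (v x)%:E)%E).
    by apply: (ge0_le_EFin_integral leb mO (mlev 0) (@subIsetl _ _ _) mv v0).
  by rewrite /M EFinD fineK// leeDl// lee_fin.
have := degiorgi_iteration a1 (mulr_gt0 lam0 K0) mle m0 step.
rewrite (_ : lam * K * _ / _ = K * 2 `^ a / (a - 1) * lam); last by ring.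
by move=> mle0; apply/eqP; rewrite eq_le mle0 m_ge0.
Qed.

End boundedness.

Section solutions.
Context {R : realType} {n : nat}.
Local Notation Rn := 'rV[R]_n.+1.

(** Finite energy of [phi] makes the integrand integrable; otherwise negation need not commute with
    an extended integral whose positive and negative parts are both infinite. *)
Lemma weak_lhs_opp (Omega : set Rn) (p : R) (Q : Rn -> 'M[R]_n.+1)
    (U : Rn -> 'cV[R]_n.+1) (phi : Rn -> R) :
  measurable Omega -> 1 < p -> measurable_mx_field Omega Q ->
  (forall x, Omega x -> (Q x)^T = Q x /\ nonneg_def (Q x)) ->
  in_QLp p Q Omega U -> Lip0 Omega phi -> (QLp_norm p Q Omega (grad phi) < +oo)%E ->
  (weak_lhs p Q Omega (fun x => (- U x)%R) phi = - weak_lhs p Q Omega U phi)%E.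
Proof.
move=> mO p1 mQ Qsym [mU nU] lphi nphi; have p0 : 0 < p by lra.
have mgphi := measurable_grad mO lphi.
have i0 (F : Rn -> 'cV[R]_n.+1) :
    (0 <= \int[leb]_(x in Omega) (enorm (sqrtmx (Q x) *m F x) `^ p)%:E)%E.
  by apply: integral_ge0 => x _; rewrite lee_fin powR_ge0.
have [W _ iW] := poweR_inv_lty (i0 U) p0 nU.
have [Z _ iZ] := poweR_inv_lty (i0 (grad phi)) p0 nphi.
have sle x : Omega x -> `|dot (grad phi x) (Q x *m U x)| <=
    enorm (sqrtmx (Q x) *m U x) * enorm (sqrtmx (Q x) *m grad phi x).
  move=> Ox; have [Qs Qn] := Qsym x Ox.
  by rewrite dot_sqrtmx// mulrC dot_le_enorm.
have intg := weak_integrand_integrable mO p1 (measurable_enorm_sqrtmx mQ Qsym mU)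
  (measurable_enorm_sqrtmx mQ Qsym mgphi) (measurable_dot mgphi (measurable_mulmx mQ mU))
  (fun x _ => enorm_ge0 _) (fun x _ => enorm_ge0 _) sle iW iZ.
rewrite -(integral_EFinN mO intg) /weak_lhs.
suff E : (fun x => (enorm (sqrtmx (Q x) *m - U x) `^ (p - 2) *
      dot (grad phi x) (Q x *m - U x))%:E) =
    (fun x => (- (enorm (sqrtmx (Q x) *m U x) `^ (p - 2) *
      dot (grad phi x) (Q x *m U x)))%:E) by rewrite E.
apply/funext => x; by rewrite !mulmxN enormN dotNr mulrN.
Qed.

Lemma weak_rhs_le (Omega : set Rn) (p : R) (v f g phi : Rn -> R)
    (t : Rn -> 'cV[R]_n.+1) : measurable Omega -> 1 < p -> weight Omega v ->
  measurable_field Omega t -> measurable_fun Omega f -> measurable_fun Omega g ->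
  Lip0 Omega phi -> (forall x, 0 <= phi x) ->
  (`| weak_rhs p v t Omega f g phi | <= \int[leb]_(x in Omega)
    ((`|f x| `^ (p - 1) * phi x + `|g x| `^ (p - 1) * `|dot (t x) (grad phi x)|) * v x)%:E)%E.
Proof.
move=> mO p1 [mv v0] mt mf mg lphi phi0.
exact: (abs_source_integral leb mO p1 mf mg
  (rV_continuous_measurable mO (Lip0_continuous lphi))
  (measurable_dot mt (measurable_grad mO lphi)) mv (fun x _ => phi0 x) v0).
Qed.

(** Null sets are known only for [lam] strictly above [X], so the bound is reached through
    [lam = X + e / C]. *)
Lemma Linfty_norm_le (Omega : set Rn) (v h : Rn -> R) (C : R) (X : \bar R) :
  0 < C -> (0 <= X < +oo)%E ->
  (forall lam : R, (X < lam%:E)%E ->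
    weight_of v (Omega `&` [set x | C * lam < `|h x|]) = 0%E) ->
  (Linfty_norm v Omega h <= C%:E * X)%E.
Proof.
move=> C0 /andP[X0 Xoo]; have Xfin : X \is a fin_num by rewrite ge0_fin_numE.
rewrite -(fineK Xfin); have r0 : 0 <= fine X by exact: fine_ge0.
move: (fine X) r0 => r r0 null.
apply/lee_addgt0Pr => e e0; have lam0 : 0 < r + e / C by rewrite ltr_wpDl// divr_gt0.
apply: (@le_trans _ _ (C * (r + e / C))%:E).
  apply: ereal_inf_lbound; exists (C * (r + e / C)) => //; split.
    by rewrite mulr_ge0// ltW.
  by apply: null; rewrite lte_fin ltrDl divr_gt0.
by rewrite -EFinM -EFinD lee_fin mulrDr mulrC (mulrC C (e / C)) divfK ?gt_eqF// mulrC.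
Qed.

End solutions.

Theorem theorem1p1 (R : realType) (n : nat) (Omega : set 'rV[R]_n.+1)
    (p sigma q S_N Ct : R)
    (v : 'rV[R]_n.+1 -> R) (t : 'rV[R]_n.+1 -> 'cV[R]_n.+1)
    (Omega_domain : bounded_domain Omega)
    (p_gt1 : 1 < p)
    (v_weight : weight Omega v)
    (v_L1 : leb.-integrable Omega (EFin \o v))
    (t_meas : measurable_field Omega t)
    (sigma_gt1 : 1 < sigma)
    (q_gt : conjugate sigma * (p - 1) < q) :
  exists C : R, 0 < C /\
  forall (Q : 'rV[R]_n.+1 -> 'M[R]_n.+1) (k : R),
    measurable_mx_field Omega Q ->
    (forall x, Omega x -> (Q x)^T = Q x /\ nonneg_def (Q x)) ->
    (\forall x \ae leb, Omega x -> opnorm (Q x) `^ (p / 2) <= k * v x) ->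
    degenerate_subunit p v Q Omega t Ct ->
    sobolev_inequality (Nfun sigma p) p v Q Omega S_N ->
    forall f g : 'rV[R]_n.+1 -> R,
      in_orlicz (Afun sigma p q) v Omega f ->
      in_orlicz (Bfun sigma p q) v Omega g ->
      let bound := (C%:E * (orlicz_norm (Afun sigma p q) v Omega f
                            + orlicz_norm (Bfun sigma p q) v Omega g))%E in
      [/\ forall (u : 'rV[R]_n.+1 -> R) (U : 'rV[R]_n.+1 -> 'cV[R]_n.+1),
            weak_subsolution p v Q t Omega f g u U ->
            (Linfty_norm v Omega (u^\+)%R <= bound)%E,
          forall (u : 'rV[R]_n.+1 -> R) (U : 'rV[R]_n.+1 -> 'cV[R]_n.+1),
            weak_supersolution p v Q t Omega f g u U ->
            (Linfty_norm v Omega (u^\-)%R <= bound)%E &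
          forall (u : 'rV[R]_n.+1 -> R) (U : 'rV[R]_n.+1 -> 'cV[R]_n.+1),
            weak_solution p v Q t Omega f g u U ->
            in_Linfty v Omega u /\ (Linfty_norm v Omega u <= bound)%E].
Proof.
have [oO _ _ _] := Omega_domain.
have mO : measurable Omega := rV_open_measurable oO.
have [mv v0] := v_weight.
(* For [Ct <= 0] no field satisfies [degenerate_subunit], and any constant will do. *)
have [Ct0|Ct0] := ltP 0 Ct; last first.
  by exists 1; split=> // Q k _ _ _ [/lt_geF]; rewrite Ct0.
have [C C0 null] := sublevel_null S_N oO p_gt1 v_weight v_L1 t_meas sigma_gt1 q_gt Ct0.
exists C; split=> // Q k mQ Qsym _ sub sob f g [mf nf] [mg ng] bound.
set X := (orlicz_norm (Afun sigma p q) v Omega f +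
          orlicz_norm (Bfun sigma p q) v Omega g)%E in bound *.
have f0 := orlicz_norm_ge0 (Afun sigma p q) v f Omega.
have g0 := orlicz_norm_ge0 (Bfun sigma p q) v g Omega.
have X0 : (0 <= X < +oo)%E by apply/andP; split; [exact: adde_ge0 f0 g0|exact: lte_add_pinfty nf ng].
have flt lam : (X < lam%:E)%E -> (orlicz_norm (Afun sigma p q) v Omega f < lam%:E)%E.
  by apply: le_lt_trans; exact: leeDl g0.
have glt lam : (X < lam%:E)%E -> (orlicz_norm (Bfun sigma p q) v Omega g < lam%:E)%E.
  by apply: le_lt_trans; exact: leeDr f0.
have lam_ge0 lam : (X < lam%:E)%E -> 0 <= C * lam.
  move=> Xl; apply: mulr_ge0 (ltW C0) _; rewrite -lee_fin.
  by apply: le_trans (ltW Xl); have /andP[] := X0.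
have subnull u U lam : weak_subsolution p v Q t Omega f g u U -> (X < lam%:E)%E ->
    weight_of v (Omega `&` [set x | C * lam < u x]) = 0%E.
  move=> [uQH weak] Xl; apply: (null Q f g u U lam mQ Qsym sub sob mf mg (flt _ Xl) (glt _ Xl) uQH).
  move=> phi lphi phi0 _; apply: le_trans (weak phi lphi phi0) _.
  apply: le_trans (lee_abs _) _.
  exact: (weak_rhs_le mO p_gt1 v_weight t_meas mf mg lphi phi0).
have supernull u U lam : weak_supersolution p v Q t Omega f g u U -> (X < lam%:E)%E ->
    weight_of v (Omega `&` [set x | C * lam < - u x]) = 0%E.
  move=> [uQH weak] Xl; apply: (null Q f g (\- u) (fun x => - U x) lam mQ Qsym sub sob mf mg
    (flt _ Xl) (glt _ Xl) (in_QH0N uQH)).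
  move=> phi lphi phi0 nphi; have [_ inU _] := uQH.
  rewrite (weak_lhs_opp mO p_gt1 mQ Qsym inU lphi nphi).
  have := weak phi lphi phi0; rewrite -leeN2 => /le_trans; apply.
  apply: le_trans (lee_abs _) _; rewrite abseN.
  exact: (weak_rhs_le mO p_gt1 v_weight t_meas mf mg lphi phi0).
split=> u U.
- move=> usub; apply: (Linfty_norm_le C0 X0) => lam Xl.
  rewrite -(subnull u U lam usub Xl); congr (weight_of v (Omega `&` _)).
  apply/seteqP; split => x /=; rewrite /funrpos ger0_norm ?le_max ?lexx ?orbT// lt_max.
    by move=> /orP[//|]; rewrite ltNge lam_ge0.
  by move=> ->.
- move=> usup; apply: (Linfty_norm_le C0 X0) => lam Xl.
  rewrite -(supernull u U lam usup Xl); congr (weight_of v (Omega `&` _)).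
  apply/seteqP; split => x /=; rewrite /funrneg ger0_norm ?le_max ?lexx ?orbT// lt_max.
    by move=> /orP[//|]; rewrite ltNge lam_ge0.
  by move=> ->.
move=> [uQH weak]; have [[mu_ _] _ _] := uQH.
have uinf : (Linfty_norm v Omega u <= bound)%E.
  apply: (Linfty_norm_le C0 X0) => lam Xl.
  have usub : weak_subsolution p v Q t Omega f g u U.
    by split=> // phi lphi _; rewrite weak.
  have usup : weak_supersolution p v Q t Omega f g u U.
    by split=> // phi lphi _; rewrite weak.
  have mnu : measurable_fun Omega (\- u) := measurable_funN mu_.
  have mau : measurable_fun Omega (fun x => `|u x|) := measurableT_comp (@normr_measurable R setT) mu_.
  (* The set is a union of two null sets at the same level, so the constant is not doubled. *)
  have le0 : (weight_of v (Omega `&` [set x | (C * lam < `|u x|)%R]) <= (0 + 0)%:E)%E.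
    apply: (@integral_subsetU _ _ _ leb Omega _ _ _ v 0 0 mO
      (measurable_superlevel (C * lam) mO mau) (measurable_superlevel (C * lam) mO mu_)
      (measurable_superlevel (C * lam) mO mnu) _ _ _ mv v0).
    + move=> x [Ox /=]; rewrite ltr_normr => /orP[h|h]; first by left.
      by right.
    + exact: subIsetl.
    + exact: subIsetl.
    + by have := subnull u U lam usub Xl; rewrite /weight_of => ->.
    + by have := supernull u U lam usup Xl; rewrite /weight_of => ->.
  apply/eqP; rewrite eq_le; rewrite addr0 in le0; rewrite le0/=.
  by apply: integral_ge0 => x [Ox _]; rewrite lee_fin v0.
split=> //; split=> //.
apply: (le_lt_trans uinf); rewrite /bound lte_mul_pinfty ?lee_fin ?(ltW C0)//.
by have /andP[] := X0.
Qed.
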